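(* Let $J\subseteq I$. (a) $Or(J)$ is $G_{fn}$-invariant and $P(J)\in Or(J)$. (b) $Or(J)$ is open and dense in $\overline{Or(J)}$. In particular, $Or(\emptyset)$ is open and dense in $\mathrm{Proj}(CA)$. (c) It holds $$\overline{Or(J)}=\dot{\bigcup_{I\supseteq K\supseteq J}}Or(K)\quad\text{(disjoint union)}.$$ In particular, $\mathrm{Proj}(CA)=\dot{\bigcup}_{K\subseteq I}Or(K)$.
   Context: Setting. $\mathbb F$ is a field of characteristic $0$. $A=(a_{ij})_{i,j\in I}$, $I=\{1,\dots,n\}$, is a symmetrizable generalized Cartan matrix of rank $l$. $H,P$ are dual free $\mathbb Z$-modules of rank $2n-l$ with dual bases $h_1,\dots,h_{2n-l}$ of $H$ and $\Lambda_1,\dots,\Lambda_{2n-l}$ of $P$, together with linearly independent $\alpha_1,\dots,\alpha_n\in P$ such that $\alpha_i(h_j)=a_{ji}$ ($i,j\in I$). $P^+=\{\Lambda\in P:\Lambda(h_i)\ge 0\ \forall i\in I\}$, $Q_0^+=\sum_{i\in I}\mathbb Z_{\ge0}\alpha_i$, $\mathfrak h=H\otimes\mathbb F$, $\mathfrak h^*=P\otimes\mathbb F$. For $J\subseteq I$, $\overline{F_J}=\{\lambda\in P\otimes\mathbb R:\lambda(h_i)=0\ (i\in J),\ \lambda(h_i)\ge0\ (i\in I\setminus J)\}$. The Weyl group $\mathcal W$ is generated by $\sigma_i\lambda=\lambda-\lambda(h_i)\alpha_i$ ($i\in I$). $\mathfrak g$ is the Kac-Moody algebra over $\mathbb F$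 generated by the abelian Lie algebra $\mathfrak h$ and $e_i,f_i$ ($i\in I$) with relations $[e_i,f_j]=\delta_{ij}h_i$, $[h,e_i]=\alpha_i(h)e_i$, $[h,f_i]=-\alpha_i(h)f_i$, $(\mathrm{ad}\,e_i)^{1-a_{ij}}e_j=(\mathrm{ad}\,f_i)^{1-a_{ij}}f_j=0$ ($i\ne j$). $\mathfrak g_\alpha$ are the root spaces, $\Delta$ the roots, $\Delta^\pm=\Delta\cap(\pm Q_0^+)$, $\Delta_{re}=\mathcal W\{\alpha_i\}_{i\in I}$. $L(\Lambda)$, $\Lambda\in P^+$, is the irreducible highest weight $\mathfrak g$-module with set of weights $P(\Lambda)$; $L(\Lambda)^{( * )}=\bigoplus_{\lambda\in P(\Lambda)}L(\Lambda)_\lambda^*$ is its restricted dual; $L(\Lambda)_f=\prod_{\lambda\in P(\Lambda)}L(\Lambda)_\lambda=(L(\Lambda)^{( * )})^*$; $L(\Lambda)^{( * )}_{\ne\Lambda}=\bigoplus_{\lambda\in P(\Lambda)\setminus\{\Lambda\}}L(\Lambda)_\lambda^*$ (a sum over the empty set is $\{0\}$). Formal Kac-Moody group. A $\mathfrak g$-module is integrable if it is $\mathfrak h$-diagonalizable with weights in $P$ and $\mathfrak g_\alpha$ acts locally nilpotently for all $\alpha\in\Delta_{re}$. $\mathcal O^n_{int}$ is the category of integrable modules with finite-dimensional weight spaces whose weights lie in a finite union of sets $\{\lambda\in\mathfrak h^*:\lambda-\lambda_i\in Q_0^+\}$; $\mathfrak n_f^-:=\prod_{\alpha\in\Delta^-}\mathfrak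 g_\alpha$ acts on these modules, and each $L(\Lambda)^{( * )}$ (with the dual action) belongs to $\mathcal O^n_{int}$. $G_{fn}$ is the group, inside the algebra of natural endomorphisms of the forgetful functor $\mathcal O^n_{int}\to\mathbb F$-vector spaces, generated by $t_h(s)$ ($h\in H,s\in\mathbb F^\times$), acting on weight spaces $V_\lambda$ by $s^{\lambda(h)}$, and $\exp(x)=\sum_k x^k/k!$ for $x\in\mathfrak n_f^-\cup\bigcup_{\alpha\in\Delta_{re}\cap\Delta^+}\mathfrak g_\alpha$. It acts on $L(\Lambda)^{( * )}$ and dually on $L(\Lambda)_f$. For $g\in G_{fn}$, $\phi\in L(\Lambda)^{( * )}$ put $(\pi(g)\phi)(v)=\phi(gv)$. Cartan algebra. Fix highest weight vectors $v_\Lambda\in L(\Lambda)_\Lambda\setminus\{0\}$. $CA=\bigoplus_{\Lambda\in P^+}L(\Lambda)^{( * )}$ is the $P^+$-graded commutative algebra (without zero divisors) whose product of $\phi\in L(\Lambda)^{( * )}$ and $\psi\in L(N)^{( * )}$ is $(\phi\otimes\psi)\circ\Phi\in L(\Lambda+N)^{( * )}$, where $\Phi:L(\Lambda+N)\to L(\Lambda)\otimes L(N)$ is the $\mathfrak g$-equivariant map with $\Phi(v_{\Lambda+N})=v_\Lambda\otimes v_N$. $\mathrm{Proj}(CA)$ is the set of all $P^+$-homogeneous prime ideals of $CA$ (none excluded) with closed sets $\mathcal V(\mathfrak a)=\{Q:Q\supseteq\mathfrak a\}$, $\mathfrak a$ a homogeneous ideal. $G_{fn}$ acts on $\mathrm{Proj}(CA)$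 by $gQ:=\pi(g)^{-1}(Q)$. For $J\subseteq I$: $P(J):=\bigoplus_{\Lambda\in P^+\cap\overline{F_J}}L(\Lambda)^{( * )}_{\neq\Lambda}\oplus\bigoplus_{\Lambda\in P^+\setminus\overline{F_J}}L(\Lambda)^{( * )}$; $\overline{Or(J)}:=\mathcal V\big(\bigoplus_{\Lambda\in P^+\setminus\overline{F_J}}L(\Lambda)^{( * )}\big)$, where $\bigoplus_{\Lambda\in P^+\setminus\overline{F_J}}L(\Lambda)^{( * )}$ is a homogeneous prime ideal; $Or(J):=\overline{Or(J)}\setminus\bigcup_{J\subsetneq K\subseteq I}\overline{Or(K)}$. *)

(* Defs.v *)
From HB Require Import structures.
From mathcomp Require Import all_boot all_order all_algebra.
From mathcomp Require Import all_classical all_reals all_analysis.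
From mathcomp Require Import generic_quotient.

Set Implicit Arguments.
Unset Strict Implicit.
Unset Printing Implicit Defensive.

Import Order.TTheory GRing.Theory Num.Theory.
Local Open Scope classical_set_scope.
Local Open Scope ring_scope.
Local Open Scope quotient_scope.

Section CartanMatrix.
Variables (n : nat) (A : 'M[int]_n).

Definition gcm : Prop :=
  (forall i, A i i = 2) /\
  (forall i j, i != j -> A i j <= 0 /\ (A i j = 0 -> A j i = 0)).

Definition symmetrizable : Prop :=
  exists2 d : 'rV[rat]_n, (forall i, d 0 i != 0) &
    let DA := diag_mx d *m map_mx intr A in DA = DA^T.

(* The rank of H and P is 2 n - l with l = \rank A; it is written n + (n - l)
   so that [lshift] embeds I into the index set of the bases. *)
Definition dimH : nat := n + (n - \rank (map_mx intr A : 'M[rat]_n)).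

(* H, P and their scalar extensions are the coordinate spaces 'rV_dimH with
   respect to the dual bases (h_k) and (Lambda_k). *)
Definition pairing (R : pzRingType) (lam h : 'rV[R]_dimH) : R :=
  \sum_k lam 0 k * h 0 k.

Definition hI (R : pzRingType) (i : 'I_n) : 'rV[R]_dimH :=
  delta_mx 0 (lshift _ i).

Definition simple_root (alpha : 'M[int]_(n, dimH)) (i : 'I_n) : 'rV[int]_dimH :=
  row i alpha.

Definition realization (alpha : 'M[int]_(n, dimH)) : Prop :=
  row_free (map_mx intr alpha : 'M[rat]_(n, dimH)) /\
  (forall i j, pairing (simple_root alpha i) (hI int j) = A j i).

Definition dominant : {pred 'rV[int]_dimH} :=
  fun Lam => [forall i, 0 <= pairing Lam (hI int i)].

(* The closed facet as a subset of P (x) K; its intersection with P is the case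
   K = int. *)
Definition closed_facet (K : numDomainType) (J : {set 'I_n}) :
    set 'rV[K]_dimH :=
  [set lam | (forall i, i \in J -> pairing lam (hI K i) = 0) /\
             (forall i, i \notin J -> 0 <= pairing lam (hI K i))].

Lemma pairingDl (R : pzRingType) (x y h : 'rV[R]_dimH) :
  pairing (x + y) h = pairing x h + pairing y h.
Proof. by rewrite /pairing -big_split; apply: eq_bigr => k _; rewrite mxE mulrDl. Qed.

Lemma pairingDr (R : pzRingType) (x y h : 'rV[R]_dimH) :
  pairing h (x + y) = pairing h x + pairing h y.
Proof. by rewrite /pairing -big_split; apply: eq_bigr => k _; rewrite mxE mulrDr. Qed.

Fact dominant_closed : GRing.nmod_closed dominant.
Proof.
split; first by apply/forallP => i; rewrite /pairing big1 // => k _; rewrite mxE mul0r.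
by move=> x y /forallP x0 /forallP y0; apply/forallP => i; rewrite pairingDl addr_ge0.
Qed.

Record Pplus := MkPplus { Pplus_val :> 'rV[int]_dimH; _ : dominant Pplus_val }.
HB.instance Definition _ := [isSub for Pplus_val].
HB.instance Definition _ := [Choice of Pplus by <:].
HB.instance Definition _ :=
  GRing.SubChoice_isSubNmodule.Build _ _ Pplus dominant_closed.

End CartanMatrix.

Section KacMoody.
Variables (F : fieldType) (n : nat) (A : 'M[int]_n) (alpha : 'M[int]_(n, dimH A)).

Notation P := 'rV[int]_(dimH A).
Notation fh := 'rV[F]_(dimH A).   (* both h and its dual *)
Notation alpha_ := (simple_root alpha).

Definition inF (lam : P) : fh := map_mx intr lam.

Inductive lterm : Type :=
| Te of 'I_n | Tf of 'I_n | Th of fh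
| T0 | Tadd of lterm & lterm | Tscale of F & lterm | Tbr of lterm & lterm.

HB.instance Definition _ := gen_eqMixin lterm.
HB.instance Definition _ := gen_choiceMixin lterm.

(* The least congruence on Lie terms that contains the Lie algebra axioms and the
   defining relations. *)
Inductive lrel : lterm -> lterm -> Prop :=
| lrefl x : lrel x x
| lsym x y : lrel x y -> lrel y x
| ltrans y x z : lrel x y -> lrel y z -> lrel x z
| lcongD x x' y y' : lrel x x' -> lrel y y' -> lrel (Tadd x y) (Tadd x' y')
| lcongZ c x x' : lrel x x' -> lrel (Tscale c x) (Tscale c x')
| lcongB x x' y y' : lrel x x' -> lrel y y' -> lrel (Tbr x y) (Tbr x' y')
| laddA x y z : lrel (Tadd x (Tadd y z)) (Tadd (Tadd x y) z)
| laddC x y : lrel (Tadd x y) (Tadd y x)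
| ladd0 x : lrel (Tadd T0 x) x
| laddN x : lrel (Tadd (Tscale (-1) x) x) T0
| lscaleA a b x : lrel (Tscale a (Tscale b x)) (Tscale (a * b) x)
| lscale1 x : lrel (Tscale 1 x) x
| lscaleDr a x y : lrel (Tscale a (Tadd x y)) (Tadd (Tscale a x) (Tscale a y))
| lscaleDl a b x : lrel (Tscale (a + b) x) (Tadd (Tscale a x) (Tscale b x))
| lbrDl x y z : lrel (Tbr (Tadd x y) z) (Tadd (Tbr x z) (Tbr y z))
| lbrZl a x z : lrel (Tbr (Tscale a x) z) (Tscale a (Tbr x z))
| lbrDr x y z : lrel (Tbr z (Tadd x y)) (Tadd (Tbr z x) (Tbr z y))
| lbrZr a x z : lrel (Tbr z (Tscale a x)) (Tscale a (Tbr z x))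
| lbrxx x : lrel (Tbr x x) T0
| ljacobi x y z :
    lrel (Tadd (Tbr x (Tbr y z)) (Tadd (Tbr y (Tbr z x)) (Tbr z (Tbr x y)))) T0
| lThD h h' : lrel (Th (h + h')) (Tadd (Th h) (Th h'))
| lThZ c h : lrel (Th (c *: h)) (Tscale c (Th h))
| lhh h h' : lrel (Tbr (Th h) (Th h')) T0
| lef i j : lrel (Tbr (Te i) (Tf j)) (if i == j then Th (hI A F i) else T0)
| lhe h i : lrel (Tbr (Th h) (Te i)) (Tscale (pairing (inF (alpha_ i)) h) (Te i))
| lhf h i : lrel (Tbr (Th h) (Tf i)) (Tscale (- pairing (inF (alpha_ i)) h) (Tf i))
| lserre_e i j : i != j -> lrel (iter `|1 - A i j|%N (Tbr (Te i)) (Te j)) T0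
| lserre_f i j : i != j -> lrel (iter `|1 - A i j|%N (Tbr (Tf i)) (Tf j)) T0.

Definition lrelb (x y : lterm) : bool := `[< lrel x y >].

Fact lrelb_equiv : equiv_class_of lrelb.
Proof.
split; first by move=> x; apply/asboolP/lrefl.
- by move=> x y; apply/asboolP/asboolP; apply: lsym.
- by move=> y x z /asboolP xy /asboolP yz; apply/asboolP/(ltrans xy yz).
Qed.
Canonical lrelb_equiv_rel := EquivRelPack lrelb_equiv.

Definition km := {eq_quot lrelb}.
HB.instance Definition _ := Choice.on km.

Let cls (x : lterm) : km := \pi_km x.

Lemma km_relP x y : lrel x y <-> cls x = cls y.
Proof.
split=> [xy|/eqmodP/asboolP//]; apply/eqmodP; exact/asboolP.
Qed.

Lemma km_reprP (x : km) : {t | x = cls t}.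
Proof. by exists (repr x); rewrite /cls reprK. Qed.

Let km_op1 (op : lterm -> lterm) (x : km) : km := cls (op (repr x)).
Let km_op2 (op : lterm -> lterm -> lterm) (x y : km) : km :=
  cls (op (repr x) (repr y)).

Let reprcls x : lrel (repr (cls x)) x.
Proof. by apply/km_relP; rewrite /cls reprK. Qed.

Definition km_add := km_op2 Tadd.
Definition km_scale (c : F) := km_op1 (Tscale c).
Definition bracket := km_op2 Tbr.
Definition km_e i : km := cls (Te i).
Definition km_f i : km := cls (Tf i).
Definition km_h h : km := cls (Th h).

Let addE x y : km_add (cls x) (cls y) = cls (Tadd x y).
Proof. by apply/km_relP/lcongD. Qed.
Let scaleE c x : km_scale c (cls x) = cls (Tscale c x).
Proof. by apply/km_relP/lcongZ. Qed.
Let brE x y : bracket (cls x) (cls y) = cls (Tbr x y).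
Proof. by apply/km_relP/lcongB. Qed.

Let kmaddA : associative km_add.
Proof.
move=> x y z; case: (km_reprP x) (km_reprP y) (km_reprP z) => a -> [b ->] [c ->].
by rewrite !addE; apply/km_relP/laddA.
Qed.
Let kmaddC : commutative km_add.
Proof.
move=> x y; case: (km_reprP x) (km_reprP y) => a -> [b ->].
by rewrite !addE; apply/km_relP/laddC.
Qed.
Let kmadd0 : left_id (cls T0) km_add.
Proof. by move=> x; case: (km_reprP x) => a ->; rewrite addE; apply/km_relP/ladd0. Qed.
Let kmaddN : left_inverse (cls T0) (km_scale (-1)) km_add.
Proof.
by move=> x; case: (km_reprP x) => a ->; rewrite scaleE addE; apply/km_relP/laddN.
Qed.
HB.instance Definition _ := GRing.isZmodule.Build km kmaddA kmaddC kmadd0 kmaddN.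

Let kmscaleA a b x : km_scale a (km_scale b x) = km_scale (a * b) x.
Proof. by case: (km_reprP x) => t ->; rewrite !scaleE; apply/km_relP/lscaleA. Qed.
Let kmscale1 : left_id 1 km_scale.
Proof. by move=> x; case: (km_reprP x) => t ->; rewrite !scaleE; apply/km_relP/lscale1. Qed.
Let kmscaleDr : right_distributive km_scale +%R.
Proof.
move=> c x y; case: (km_reprP x) (km_reprP y) => a -> [b ->].
by rewrite [LHS](congr1 _ (addE _ _)) !scaleE [RHS]addE; apply/km_relP/lscaleDr.
Qed.
Let kmscaleDl x : {morph km_scale^~ x : a b / a + b}.
Proof.
by move=> a b; case: (km_reprP x) => t ->; rewrite !scaleE [RHS]addE; apply/km_relP/lscaleDl.
Qed.
HB.instance Definition _ := GRing.Zmodule_isLmodule.Build F km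
  kmscaleA kmscale1 kmscaleDr kmscaleDl.

Let DE x y : cls x + cls y = cls (Tadd x y). Proof. exact: addE. Qed.
Let ZE c x : c *: cls x = cls (Tscale c x). Proof. exact: scaleE. Qed.

Lemma km_ind (S : km -> Prop) :
    (forall i, S (km_e i)) -> (forall i, S (km_f i)) -> (forall h, S (km_h h)) ->
    S 0 -> (forall x y, S x -> S y -> S (x + y)) ->
    (forall c x, S x -> S (c *: x)) ->
    (forall x y, S x -> S y -> S (bracket x y)) ->
  forall x, S x.
Proof.
move=> Se Sf Sh S0 SD SZ SB x; case: (km_reprP x) => t ->.
elim: t => [i|i|h||a Sa b Sb|c a Sa|a Sa b Sb].
- exact: Se.
- exact: Sf.
- exact: Sh.
- exact: S0.
- by rewrite -DE; apply: SD.
- by rewrite -ZE; apply: SZ.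
- by rewrite -brE; apply: SB.
Qed.

Lemma bracketDl x y z : bracket (x + y) z = bracket x z + bracket y z.
Proof.
case: (km_reprP x) (km_reprP y) (km_reprP z) => a -> [b ->] [c ->].
by rewrite DE !brE DE; apply/km_relP/lbrDl.
Qed.
Lemma bracketZl a x z : bracket (a *: x) z = a *: bracket x z.
Proof.
case: (km_reprP x) (km_reprP z) => u -> [v ->].
by rewrite ZE !brE ZE; apply/km_relP/lbrZl.
Qed.
Lemma bracketDr x y z : bracket z (x + y) = bracket z x + bracket z y.
Proof.
case: (km_reprP x) (km_reprP y) (km_reprP z) => a -> [b ->] [c ->].
by rewrite DE !brE DE; apply/km_relP/lbrDr.
Qed.
Lemma bracketZr a x z : bracket z (a *: x) = a *: bracket z x.
Proof.
case: (km_reprP x) (km_reprP z) => u -> [v ->].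
by rewrite ZE !brE ZE; apply/km_relP/lbrZr.
Qed.
Lemma bracketxx x : bracket x x = 0.
Proof. by case: (km_reprP x) => a ->; rewrite brE; apply/km_relP/lbrxx. Qed.
Lemma jacobi x y z :
  bracket x (bracket y z) + (bracket y (bracket z x) + bracket z (bracket x y)) = 0.
Proof.
case: (km_reprP x) (km_reprP y) (km_reprP z) => a -> [b ->] [c ->].
by rewrite !brE !DE; apply/km_relP/ljacobi.
Qed.
Lemma km_hD h h' : km_h (h + h') = km_h h + km_h h'.
Proof. by rewrite DE; apply/km_relP/lThD. Qed.
Lemma km_hZ c h : km_h (c *: h) = c *: km_h h.
Proof. by rewrite ZE; apply/km_relP/lThZ. Qed.
Lemma bracket_hh h h' : bracket (km_h h) (km_h h') = 0.
Proof. by rewrite brE; apply/km_relP/lhh. Qed.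
Lemma bracket_ef i j :
  bracket (km_e i) (km_f j) = if i == j then km_h (hI A F i) else 0.
Proof. by rewrite brE [LHS](iffLR (km_relP _ _) (lef i j)); case: eqP. Qed.
Lemma bracket_he h i :
  bracket (km_h h) (km_e i) = pairing (inF (alpha_ i)) h *: km_e i.
Proof. by rewrite brE ZE; apply/km_relP/lhe. Qed.
Lemma bracket_hf h i :
  bracket (km_h h) (km_f i) = - pairing (inF (alpha_ i)) h *: km_f i.
Proof. by rewrite brE ZE; apply/km_relP/lhf. Qed.
Lemma serre_e i j : i != j -> iter `|1 - A i j|%N (bracket (km_e i)) (km_e j) = 0.
Proof.
move=> ij; transitivity (cls (iter `|1 - A i j|%N (Tbr (Te i)) (Te j))).
  by elim: `|_|%N => //= k ->; rewrite brE.
exact/km_relP/lserre_e.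
Qed.
Lemma serre_f i j : i != j -> iter `|1 - A i j|%N (bracket (km_f i)) (km_f j) = 0.
Proof.
move=> ij; transitivity (cls (iter `|1 - A i j|%N (Tbr (Tf i)) (Tf j))).
  by elim: `|_|%N => //= k ->; rewrite brE.
exact/km_relP/lserre_f.
Qed.
End KacMoody.

Section Modules.
Variables (F : fieldType) (n : nat) (A : 'M[int]_n) (alpha : 'M[int]_(n, dimH A)).

Notation P := 'rV[int]_(dimH A).
Notation fh := 'rV[F]_(dimH A).
Notation alpha_ := (simple_root alpha).
Notation g := (km F alpha).
Notation inF := (inF F).

Record gmod := Gmod {
  gsort :> lmodType F;
  gact : g -> gsort -> gsort;
  gactDl : forall x y u, gact (x + y) u = gact x u + gact y u;
  gactZl : forall c x u, gact (c *: x) u = c *: gact x u;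
  gact_linear : forall x, linear (gact x);
  gact_bracket : forall x y u,
    gact (bracket x y) u = gact x (gact y u) - gact y (gact x u) }.

HB.instance Definition _ (V : gmod) (x : g) :=
  GRing.isLinear.Build F V V _ (@gact V x) (@gact_linear V x).

Definition equivariant (V W : gmod) (f : V -> W) : Prop :=
  forall x u, f (gact x u) = gact x (f u).

Definition weight_space (V : gmod) (lam : fh) : set V :=
  [set u | forall h, gact (km_h alpha h) u = pairing lam h *: u].
Arguments weight_space : clear implicits.

Definition submodule (V : gmod) (S : set V) : Prop :=
  [/\ S 0, forall c u w, S u -> S w -> S (c *: u + w) &
      forall x u, S u -> S (gact x u)].

Definition irreducible_gmod (V : gmod) : Prop :=
  (exists u : V, u != 0) /\
  (forall S : set V, submodule S -> S = [set 0] \/ S = setT).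

Definition irreducible_hw (V : gmod) (Lam : P) (v : V) : Prop :=
  [/\ irreducible_gmod V, v != 0, weight_space V (inF Lam) v &
      forall i, gact (km_e F alpha i) v = 0].

Lemma gact0l (V : gmod) (u : V) : gact 0 u = 0.
Proof. by rewrite -(scale0r (0 : g)) gactZl scale0r. Qed.

Lemma weight_e (V : gmod) lam u i : weight_space V lam u ->
  weight_space V (lam + inF (alpha_ i)) (gact (km_e F alpha i) u).
Proof.
move=> ul h; have := gact_bracket (km_h alpha h) (km_e F alpha i) u.
rewrite bracket_he gactZl ul linearZ /= => /esym/eqP; rewrite subr_eq => /eqP ->.
by rewrite pairingDl scalerDl addrC.
Qed.

Lemma weight_f (V : gmod) lam u i : weight_space V lam u ->
  weight_space V (lam - inF (alpha_ i)) (gact (km_f F alpha i) u).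
Proof.
move=> ul h; have := gact_bracket (km_h alpha h) (km_f F alpha i) u.
rewrite bracket_hf gactZl ul linearZ /= => /esym/eqP; rewrite subr_eq => /eqP ->.
have -> : - inF (alpha_ i) = -1 *: inF (alpha_ i) by rewrite scaleN1r.
by rewrite pairingDl scalerDl addrC; congr (_ + _ *: _);
  rewrite /pairing -sumrN; apply: eq_bigr => k _; rewrite !mxE mulN1r mulNr.
Qed.

(* L^( * ): the linear forms vanishing on all but finitely many weight spaces. *)
Definition finitely_supported (V : gmod) (phi : V -> F^o) : Prop :=
  finite_set [set lam : fh | exists2 u, weight_space V lam u & phi u != 0].

Definition rdual_pred (V : gmod) (phi : V -> F^o) : bool :=
  `[< linear phi /\ finitely_supported phi >].

Fact rdual_closed (V : gmod) : GRing.submod_closed (@rdual_pred V).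
Proof.
split.
  apply/asboolP; split; first by move=> c u w; rewrite /= scaler0 addr0.
  by apply: (sub_finite_set _ (finite_set0 _)) => lam [u _ /eqP]; exact.
move=> c phi psi /asboolP[lphi fphi] /asboolP[lpsi fpsi]; apply/asboolP; split.
  move=> a u w; rewrite !fctE lphi lpsi !scalerDr !scalerA (mulrC c a).
  by rewrite addrACA.
apply: (sub_finite_set _ (_ : finite_set
  ([set lam : fh | exists2 u, weight_space V lam u & phi u != 0] `|`
   [set lam : fh | exists2 u, weight_space V lam u & psi u != 0]))); last first.
  by rewrite finite_setU.
move=> lam [u ul]; rewrite !fctE; have [->|phiu _] := eqVneq (phi u) 0.
  by rewrite scaler0 add0r; right; exists u.
by left; exists u.
Qed.

Record rdual (V : gmod) :=
  Rdual { rdual_fun :> V -> F^o; _ : rdual_pred rdual_fun }.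
HB.instance Definition _ V := [isSub for @rdual_fun V].
HB.instance Definition _ V := [Choice of rdual V by <:].
HB.instance Definition _ V :=
  GRing.SubChoice_isSubLmodule.Build F _ _ (rdual V) (rdual_closed V).

Lemma rdual_linear (V : gmod) (phi : rdual V) : linear phi.
Proof. by case: phi => f /= /asboolP[]. Qed.
HB.instance Definition _ V (phi : rdual V) :=
  GRing.isLinear.Build F V F^o _ (rdual_fun phi) (rdual_linear phi).

Lemma rdual_finite (V : gmod) (phi : rdual V) : finitely_supported phi.
Proof. by case: phi => f /= /asboolP[]. Qed.

Lemma finitely_supportedD (V : gmod) (phi psi : V -> F^o) :
  finitely_supported phi -> finitely_supported psi ->
  finitely_supported (phi + psi).
Proof.
move=> fphi fpsi; apply: (sub_finite_set _ (_ : finite_set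
  ([set lam : fh | exists2 u, weight_space V lam u & phi u != 0] `|`
   [set lam : fh | exists2 u, weight_space V lam u & psi u != 0]))); last first.
  by rewrite finite_setU.
move=> lam [u ul]; rewrite !fctE; have [->|phiu _] := eqVneq (phi u) 0.
  by rewrite add0r; right; exists u.
by left; exists u.
Qed.

Lemma finitely_supportedZ (V : gmod) c (phi : V -> F^o) :
  finitely_supported phi -> finitely_supported (c *: phi).
Proof.
move=> fphi; apply: (sub_finite_set _ fphi) => lam [u ul nz]; exists u => //.
by apply: contraNN nz => /eqP; rewrite fctE => ->; rewrite scaler0.
Qed.

Lemma finitely_supported_act (V : gmod) (x : g) (phi : {linear V -> F^o}) :
  finitely_supported phi -> finitely_supported (phi \o gact x).
Proof.
elim/km_ind: x phi => [i|i|h||x y Sx Sy|c x Sx|x y Sx Sy] phi fphi.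
- apply: (sub_finite_set _ (finite_image (fun mu => mu - inF (alpha_ i)) fphi)).
  move=> lam [u ul /= nz]; exists (lam + inF (alpha_ i)); last by rewrite addrK.
  by exists (gact (km_e F alpha i) u) => //; exact: weight_e.
- apply: (sub_finite_set _ (finite_image (fun mu => mu + inF (alpha_ i)) fphi)).
  move=> lam [u ul /= nz]; exists (lam - inF (alpha_ i)); last by rewrite subrK.
  by exists (gact (km_f F alpha i) u) => //; exact: weight_f.
- apply: (sub_finite_set _ fphi) => lam [u ul /= nz]; exists u => //.
  by apply: contraNN nz => /eqP nz; rewrite ul linearZ /= nz scaler0.
- apply: (sub_finite_set _ fphi) => lam [u ul /=].
  by rewrite gact0l linear0 eqxx.
- rewrite (_ : _ \o _ = (phi \o gact x) + (phi \o gact y)).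
    by apply: finitely_supportedD; [exact: Sx|exact: Sy].
  by apply/funext => u /=; rewrite gactDl linearD.
- rewrite (_ : _ \o _ = c *: (phi \o gact x)).
    by apply: finitely_supportedZ; exact: Sx.
  by apply/funext => u /=; rewrite gactZl linearZ.
- rewrite (_ : _ \o _ = ((phi \o gact x) \o gact y) +
                        (-1) *: ((phi \o gact y) \o gact x)).
    apply: finitely_supportedD; first by apply: Sy; exact: Sx.
    by apply: finitely_supportedZ; apply: Sx; exact: Sy.
  by apply/funext => u /=; rewrite gact_bracket linearB !fctE scaleN1r.
Qed.

Lemma rdual_act_subproof (V : gmod) x (phi : rdual V) :
  rdual_pred (fun u : V => - phi (gact x u) : F^o).
Proof.
apply/asboolP; split.
  by move=> c u w; rewrite gact_linear rdual_linear opprD -scalerN.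
rewrite (_ : (fun _ => _) = (-1) *: (phi \o gact x)).
  by apply: finitely_supportedZ; apply: finitely_supported_act; exact: rdual_finite.
by apply/funext => u; rewrite fctE scaleN1r.
Qed.

Definition rdual_act (V : gmod) (x : g) (phi : rdual V) : rdual V :=
  Rdual (rdual_act_subproof x phi).

Lemma rdualP (V : gmod) (phi psi : rdual V) : (forall u, phi u = psi u) -> phi = psi.
Proof. by move=> e; apply: val_inj; apply/funext. Qed.

Fact rdual_actDl (V : gmod) x y (phi : rdual V) :
  rdual_act (x + y) phi = rdual_act x phi + rdual_act y phi.
Proof. by apply: rdualP => u; rewrite /= gactDl linearD opprD. Qed.
Fact rdual_actZl (V : gmod) c x (phi : rdual V) : rdual_act (c *: x) phi = c *: rdual_act x phi.
Proof. by apply: rdualP => u; rewrite /= gactZl linearZ -scalerN. Qed.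
Fact rdual_act_linear (V : gmod) x : linear (@rdual_act V x).
Proof. by move=> c phi psi; apply: rdualP => u /=; rewrite opprD scalerN. Qed.
Fact rdual_act_bracket (V : gmod) x y (phi : rdual V) :
  rdual_act (bracket x y) phi =
  rdual_act x (rdual_act y phi) - rdual_act y (rdual_act x phi).
Proof.
by apply: rdualP => u /=; rewrite gact_bracket linearB /= !fctE /= !opprK opprB.
Qed.
Definition rdual_gmod (V : gmod) : gmod :=
  Gmod (@rdual_actDl V) (@rdual_actZl V) (@rdual_act_linear V) (@rdual_act_bracket V).

(* Over a field, v (x) w |-> ((phi, psi) |-> phi v * psi w) identifies V (x) W
   with a space of bilinear forms on the full duals of V and W. *)
Definition fdual (V : gmod) := {linear V -> F^o}.

Definition pure (V W : gmod) (v : V) (w : W) : fdual V -> fdual W -> F^o :=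
  fun phi psi => phi v * psi w.

Definition tens_pred (V W : gmod) (t : fdual V -> fdual W -> F^o) : bool :=
  `[< exists s : seq (V * W), t = \sum_(p <- s) pure p.1 p.2 >].

Fact tens_closed (V W : gmod) : GRing.submod_closed (@tens_pred V W).
Proof.
split; first by apply/asboolP; exists [::]; rewrite big_nil.
move=> c t t' /asboolP[s ->] /asboolP[s' ->]; apply/asboolP.
exists ([seq (c *: p.1, p.2) | p <- s] ++ s'); rewrite big_cat big_map /=.
rewrite scaler_sumr; congr (_ + _); apply: eq_bigr => p _.
apply/funext => phi; apply/funext => psi; rewrite [in RHS]/pure /= linearZ /=; exact: mulrA.
Qed.

Record tens (V W : gmod) :=
  Tens { tens_fun :> fdual V -> fdual W -> F^o; _ : tens_pred tens_fun }.
HB.instance Definition _ V W := [isSub for @tens_fun V W].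
HB.instance Definition _ V W := [Choice of tens V W by <:].
HB.instance Definition _ V W :=
  GRing.SubChoice_isSubLmodule.Build F _ _ (tens V W) (tens_closed V W).

Lemma tensP (V W : gmod) (t t' : tens V W) : (forall phi psi, t phi psi = t' phi psi) -> t = t'.
Proof. by move=> e; apply: val_inj; apply/funext => phi; apply/funext => psi; exact: e. Qed.

Fact tensor_subproof (V W : gmod) (v : V) (w : W) : tens_pred (pure v w).
Proof. by apply/asboolP; exists [:: (v, w)]; rewrite big_seq1. Qed.

Definition tensor (V W : gmod) (v : V) (w : W) : tens V W := Tens (tensor_subproof v w).

Lemma tens_sum (V W : gmod) (t : tens V W) : exists s, t = \sum_(p <- s) tensor p.1 p.2.
Proof.
case: t => t /[dup] /asboolP[s ts] tP; exists s.
by apply: val_inj; rewrite raddf_sum.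
Qed.

Lemma tens_ind (V W : gmod) (S : tens V W -> Prop) : S 0 ->
  (forall v w t, S t -> S (tensor v w + t)) -> forall t, S t.
Proof.
move=> S0 SD t; have [s ->] := tens_sum t.
by elim: s => [|p s IH]; rewrite ?big_nil ?big_cons; auto.
Qed.

Lemma tensD (V W : gmod) (t t' : tens V W) phi psi :
  (t + t') phi psi = t phi psi + t' phi psi.
Proof. by []. Qed.

Definition tens_act_fun (V W : gmod) (x : g) (t : tens V W) : fdual V -> fdual W -> F^o :=
  fun phi psi => t (phi \o gact x) psi + t phi (psi \o gact x).

Lemma tens_act_fun_tensor (V W : gmod) x (v : V) (w : W) :
  tens_act_fun x (tensor v w) = (tensor (gact x v) w + tensor v (gact x w) : tens V W) :> (_ -> _ -> _).
Proof. by apply/funext => phi; apply/funext. Qed.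

Fact tens_act_subproof (V W : gmod) x (t : tens V W) : tens_pred (tens_act_fun x t).
Proof.
elim/tens_ind: t => [|v w t IH].
  rewrite (_ : tens_act_fun _ _ = 0); first by have [] := tens_closed V W.
  by apply/funext => phi; apply/funext => psi; rewrite /tens_act_fun !fctE addr0.
have [_ clo] := tens_closed V W.
rewrite (_ : tens_act_fun _ _ =
   1 *: tens_fun (tensor (gact x v) w + tensor v (gact x w)) + tens_act_fun x t).
  by apply: clo => //; exact: valP.
apply/funext => phi; apply/funext => psi.
by rewrite scale1r -tens_act_fun_tensor; exact: addrACA.
Qed.

Definition tens_act (V W : gmod) x (t : tens V W) : tens V W := Tens (tens_act_subproof x t).

Lemma tens_act_tensor (V W : gmod) x (v : V) (w : W) :
  tens_act x (tensor v w) = tensor (gact x v) w + tensor v (gact x w).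
Proof. exact: tensP. Qed.

Lemma tens_act_linear (V W : gmod) x : linear (@tens_act V W x).
Proof.
move=> c t t'; apply: tensP => phi psi.
by rewrite /= /tens_act_fun !fctE scalerDr addrACA.
Qed.

Lemma tens_eq_on (V W : gmod) (f f' : tens V W -> tens V W) : linear f -> linear f' ->
  (forall v w, f (tensor v w) = f' (tensor v w)) -> f =1 f'.
Proof.
move=> lf lf' e; have f0 h (lh : linear h) : h (0 : tens V W) = 0 :> tens V W.
  by have := lh (-1) 0 0; rewrite scaleN1r oppr0 addr0 scaleN1r addNr.
elim/tens_ind => [|v w t IH]; first by rewrite !f0.
by rewrite -(scale1r (tensor v w)) lf lf' e IH.
Qed.

Lemma tensorDl (V W : gmod) (v v' : V) (w : W) :
  tensor (v + v') w = tensor v w + tensor v' w.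
Proof. by apply: tensP => phi psi; rewrite /= /pure linearD; exact: mulrDl. Qed.
Lemma tensorDr (V W : gmod) (v : V) (w w' : W) :
  tensor v (w + w') = tensor v w + tensor v w'.
Proof. by apply: tensP => phi psi; rewrite /= /pure linearD; exact: mulrDr. Qed.
Lemma tensorZl (V W : gmod) c (v : V) (w : W) :
  tensor (c *: v) w = c *: tensor v w.
Proof. by apply: tensP => phi psi; rewrite /= /pure linearZ; exact/esym/mulrA. Qed.
Lemma tensorZr (V W : gmod) c (v : V) (w : W) :
  tensor v (c *: w) = c *: tensor v w.
Proof. by apply: tensP => phi psi; rewrite /= /pure linearZ; exact: mulrCA. Qed.

Fact tens_actDl (V W : gmod) x y (t : tens V W) :
  tens_act (x + y) t = tens_act x t + tens_act y t.
Proof.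
move: t; apply: tens_eq_on; first exact: tens_act_linear.
  by move=> c t t'; rewrite !tens_act_linear scalerDr addrACA.
by move=> v w; rewrite !tens_act_tensor !gactDl tensorDl tensorDr addrACA.
Qed.
Fact tens_actZl (V W : gmod) c x (t : tens V W) :
  tens_act (c *: x) t = c *: tens_act x t.
Proof.
move: t; apply: tens_eq_on; first exact: tens_act_linear.
  by move=> a t t'; rewrite !tens_act_linear scalerDr !scalerA mulrC.
by move=> v w; rewrite !tens_act_tensor !gactZl scalerDr tensorZl tensorZr.
Qed.
Fact tens_act_bracket (V W : gmod) x y (t : tens V W) :
  tens_act (bracket x y) t = tens_act x (tens_act y t) - tens_act y (tens_act x t).
Proof.
move: t; apply: tens_eq_on; first exact: tens_act_linear.
  by move=> a t t'; rewrite !tens_act_linear scalerBr opprD addrACA.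
have actD z : {morph @tens_act V W z : t t' / t + t'}.
  by move=> t t'; rewrite -[t]scale1r tens_act_linear !scale1r.
move=> v w; rewrite !(tens_act_tensor, actD) !gact_bracket.
rewrite -!scaleN1r !(tensorDl, tensorDr, tensorZl, tensorZr) !scalerDr.
set a := tensor (gact x (gact y v)) w; set b := tensor _ w.
set c := tensor v _; set d := tensor v _.
set e := tensor (gact x v) (gact y w); set f := tensor (gact y v) (gact x w).
rewrite !scaleN1r [LHS]addrACA (addrC e c) (addrC (- f)) [a + f + _]addrACA.
rewrite [- b - e + _]addrACA [RHS]addrACA -[- e - f]opprD (addrC e f) subrr addr0.
by [].
Qed.

Definition tens_gmod (V W : gmod) : gmod :=
  Gmod (@tens_actDl V W) (@tens_actZl V W) (@tens_act_linear V W)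
       (@tens_act_bracket V W).
End Modules.
Arguments weight_space {F n A alpha} V lam.

Section FormalGroup.
Variables (F : fieldType) (n : nat) (A : 'M[int]_n) (alpha : 'M[int]_(n, dimH A)).

Notation P := 'rV[int]_(dimH A).
Notation fh := 'rV[F]_(dimH A).
Notation alpha_ := (simple_root alpha).
Notation g := (km F alpha).
Notation gmod := (gmod F alpha).
Notation inF := (inF F).

Definition Qplus : set P := [set \sum_i alpha_ i *+ k i | k in [set: 'I_n -> nat]].

Definition root_space (b : P) : set g :=
  [set x | forall h, bracket (km_h alpha h) x = pairing (inF b) h *: x].

Definition km_roots : set P :=
  [set b | b != 0 /\ exists2 x, root_space b x & x != 0].

Definition positive_roots : set P := [set b | km_roots b /\ Qplus b].
Definition negative_roots : set P := [set b | km_roots b /\ Qplus (- b)].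

Definition reflection (i : 'I_n) (lam : P) : P :=
  lam - pairing lam (hI A int i) *: alpha_ i.

Definition real_roots : set P :=
  [set b | exists (w : seq 'I_n) (i : 'I_n), b = foldr reflection (alpha_ i) w].

Definition is_weight (V : gmod) (lam : P) : Prop :=
  exists2 u, weight_space V (inF lam) u & u != 0.

Record integrable_gmod (V : gmod) : Prop := Integrable {
  integrable_diag : forall u : V, exists2 s : seq (P * V),
    (forall p, p \in s -> weight_space V (inF p.1) p.2) & u = \sum_(p <- s) p.2;
  integrable_nilp : forall b (x : g), real_roots b -> root_space b x ->
    forall u : V, exists k, iter k (gact x) u = 0 }.

Record Oint (V : gmod) : Prop := MkOint {
  Oint_integrable : integrable_gmod V;
  Oint_fin_dim : forall lam : P, exists s : seq V, forall u,
    weight_space V (inF lam) u -> exists c : nat -> F, u = \sum_(k < size s) c k *: s`_k;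
  Oint_bounded : exists s : seq fh, forall lam, is_weight V lam ->
    exists2 mu, mu \in s & exists2 q, Qplus q & inF lam = mu + inF q }.

Record ointmod := OintMod { omod :> gmod; omodP : Oint omod }.

Record natend := NatEnd {
  nat_fun :> forall V : ointmod, V -> V;
  nat_linear : forall V : ointmod, linear (@nat_fun V);
  nat_natural : forall (V W : ointmod) (f : V -> W), linear f -> equivariant f ->
    forall u, nat_fun (f u) = f (nat_fun u) }.
Arguments nat_fun : clear implicits.

(* The sums below are locally finite on the modules of the category: an element of
   n_f^- is a family (x b) of root vectors, and only finitely many x b, resp.
   finitely many powers, act by a nonzero vector on a given u. *)
Definition nf_act (V : gmod) (x : P -> g) (u : V) : V :=
  \sum_(b \in negative_roots) gact (x b) u.

Definition exp_act (V : lmodType F) (f : V -> V) (u : V) : V :=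
  \sum_(k \in [set: nat]) (k`!%:R : F)^-1 *: iter k f u.

Inductive Gfn_gen : natend -> Prop :=
| Gfn_torus (h : P) (s : F) (eta : natend) : s != 0 ->
    (forall (V : ointmod) (lam : P) u, weight_space V (inF lam) u ->
      eta V u = s ^ pairing lam h *: u) -> Gfn_gen eta
| Gfn_exp_nf (x : P -> g) (eta : natend) :
    (forall b, negative_roots b -> root_space b (x b)) ->
    (forall (V : ointmod) u, eta V u = exp_act (nf_act x) u) -> Gfn_gen eta
| Gfn_exp_re (b : P) (x : g) (eta : natend) :
    real_roots b -> positive_roots b -> root_space b x ->
    (forall (V : ointmod) u, eta V u = exp_act (gact x) u) -> Gfn_gen eta
| Gfn_one (eta : natend) : (forall (V : ointmod) u, eta V u = u) -> Gfn_gen eta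
| Gfn_mul (eta1 eta2 eta : natend) : Gfn_gen eta1 -> Gfn_gen eta2 ->
    (forall (V : ointmod) u, eta V u = eta1 V (eta2 V u)) -> Gfn_gen eta
| Gfn_inv (eta eta' : natend) : Gfn_gen eta ->
    (forall V : ointmod, cancel (eta V) (eta' V)) ->
    (forall V : ointmod, cancel (eta' V) (eta V)) -> Gfn_gen eta'.

Record Gfn := MkGfn {
  Gfn_fun :> natend;
  Gfn_inverse : natend;
  Gfn_funK : forall V : ointmod, cancel (Gfn_fun V) (Gfn_inverse V);
  Gfn_inverseK : forall V : ointmod, cancel (Gfn_inverse V) (Gfn_fun V);
  Gfn_funP : Gfn_gen Gfn_fun }.

Record cartan_datum := CartanDatum {
  L : Pplus A -> gmod;
  hwv : forall Lam, L Lam;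
  hwvP : forall Lam : Pplus A, irreducible_hw Lam (hwv Lam);
  Phi : forall Lam N, L (Lam + N) -> tens_gmod (L Lam) (L N);
  Phi_linear : forall Lam N, linear (@Phi Lam N);
  Phi_equivariant : forall Lam N, equivariant (@Phi Lam N);
  Phi_hwv : forall Lam N, @Phi Lam N (hwv (Lam + N)) = tensor (hwv Lam) (hwv N) }.

Section Independence.
Variable V : gmod.

Definition weighted (s : seq (fh * V)) : Prop :=
  forall p, p \in s -> weight_space V p.1 p.2.

Lemma weighted_cons p s : weighted (p :: s) -> weight_space V p.1 p.2 /\ weighted s.
Proof.
move=> ws; split; first by apply: ws; rewrite mem_head.
by move=> q qs; apply: ws; rewrite inE qs orbT.
Qed.

Lemma pairing_inj (lam mu : fh) : (forall h, pairing lam h = pairing mu h) -> lam = mu.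
Proof.
have pd nu k : pairing nu (delta_mx 0 k : fh) = nu 0 k.
  rewrite /pairing (bigD1 k) //= big1 => [|j jk]; rewrite !mxE ?eqxx ?mulr1 ?addr0 //.
  by rewrite (negPf jk) andbF mulr0.
by move=> e; apply/rowP => k; rewrite -!pd.
Qed.

Lemma weighted_sum0 s mu : weighted s -> \sum_(p <- s) p.2 = 0 ->
  \sum_(p <- s | p.1 == mu) p.2 = 0.
Proof.
have [m sm] := ubnP (size s); elim: m s sm => // m IH s sm ws s0.
have [smu|] := boolP (all (fun p => p.1 == mu) s).
  rewrite -[RHS]s0 big_seq_cond [RHS]big_seq; apply: eq_bigl => p.
  by case: (boolP (p \in s)) => //= /(allP smu) ->.
move=> /allPn[p0 p0s p0mu].
have [h hP] : exists h, pairing mu h != pairing p0.1 h.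
  apply/not_existsP => e; move/eqP: p0mu; apply; apply: pairing_inj => h.
  by have /negP/negPn/eqP := e h.
pose t := [seq (p.1, (pairing p.1 h - pairing p0.1 h) *: p.2) | p <- s & p.1 != p0.1].
have tm : (size t < m)%N.
  rewrite size_map size_filter -ltnS (leq_trans _ sm) // ltnS.
  rewrite -(count_predC (fun p => p.1 != p0.1)) -[X in (X < _)%N]addn0 ltn_add2l.
  by rewrite -has_count; apply/hasP; exists p0; rewrite //= negbK.
have : \sum_(p <- t | p.1 == mu) p.2 = 0.
  apply: (IH _ tm).
- move=> q /mapP[p]; rewrite mem_filter => /andP[_ ps] -> h' /=.
  by rewrite linearZ /= (ws _ ps) !scalerA mulrC.
- rewrite big_map big_filter.
  transitivity (\sum_(p <- s) (pairing p.1 h - pairing p0.1 h) *: p.2).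
    rewrite [RHS](bigID (fun p => p.1 != p0.1)) /= [X in _ + X]big1 ?addr0 //.
    by move=> p /negPn/eqP ->; rewrite subrr scale0r.
  transitivity (gact (km_h alpha h) (\sum_(p <- s) p.2) -
                pairing p0.1 h *: \sum_(p <- s) p.2); last first.
    by rewrite s0 linear0 scaler0 subr0.
  rewrite linear_sum scaler_sumr -sumrB big_seq [RHS]big_seq.
  by apply: eq_bigr => p ps; rewrite /= ws // scalerBl.
- rewrite big_map big_filter_cond /=.
  rewrite (eq_bigl (fun p => p.1 == mu)); last first.
    move=> p; have [->|] := eqVneq p.1 mu; last by rewrite andbF.
    rewrite andbT; apply: contraNneq p0mu => e; move: hP.
    by rewrite e eqxx.
  rewrite (eq_bigr (fun p => (pairing mu h - pairing p0.1 h) *: p.2)); last first.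
    by move=> p /eqP ->.
  rewrite -scaler_sumr => /eqP; rewrite scaler_eq0 subr_eq0 (negPf hP) => /eqP.
  exact.
Qed.

Lemma weighted_sum s mu u : weighted s -> weight_space V mu u ->
  \sum_(p <- s) p.2 = u -> \sum_(p <- s | p.1 == mu) p.2 = u.
Proof.
move=> ws uw su; have := @weighted_sum0 ((mu, - u) :: s) mu.
rewrite !big_cons /= eqxx su addNr => /(_ _ erefl)/wrap[].
  move=> p; rewrite inE => /predU1P[->|/ws//] h /=.
  by rewrite linearN /= uw scalerN.
by move/eqP; rewrite addrC subr_eq0 => /eqP.
Qed.

Definition weight_sum (u : V) : Prop :=
  exists2 s, weighted s & u = \sum_(p <- s) p.2.

Lemma weight_sum_submodule : submodule weight_sum.
Proof.
have S0 : weight_sum 0 by exists [::]; rewrite ?big_nil.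
have SD u w : weight_sum u -> weight_sum w -> weight_sum (u + w).
  move=> [s ws ->] [t wt ->]; exists (s ++ t); last by rewrite big_cat.
  by move=> p; rewrite mem_cat => /orP[/ws|/wt].
have SZ c u : weight_sum u -> weight_sum (c *: u).
  move=> [s ws ->]; exists [seq (p.1, c *: p.2) | p <- s].
    by move=> q /mapP[p ps ->] h /=; rewrite linearZ /= (ws _ ps) !scalerA mulrC.
  by rewrite big_map scaler_sumr.
have S1 lam u : weight_space V lam u -> weight_sum u.
  move=> ul; exists [:: (lam, u)]; last by rewrite big_seq1.
  by move=> p; rewrite inE => /eqP ->.
have Sact x lamf : (forall lam u, weight_space V lam u ->
    weight_space V (lamf lam) (gact x u)) ->
    forall u, weight_sum u -> weight_sum (gact x u).
  move=> wx u [s ws ->]; rewrite linear_sum /=; elim: s ws => [|p s IH] ws.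
    by rewrite big_nil.
  have [/wx/S1 wp {}ws] := weighted_cons ws.
  by rewrite big_cons; apply: SD => //; exact: IH.
split => //; first by move=> c u w Su Sw; apply: SD => //; exact: SZ.
elim/km_ind => [i|i|h||x y Sx Sy|c x Sx|x y Sx Sy] u Su.
- by apply: Sact Su => lam w; exact: weight_e.
- by apply: Sact Su => lam w; exact: weight_f.
- apply: (Sact _ id) Su => lam w wl h'; rewrite wl linearZ /= wl.
  by rewrite !scalerA mulrC.
- by rewrite gact0l.
- by rewrite gactDl; apply: SD; [exact: Sx|exact: Sy].
- by rewrite gactZl; apply: SZ; exact: Sx.
- rewrite gact_bracket -scaleN1r; apply: SD; first by apply/Sx/Sy.
  by apply/SZ/Sy/Sx.
Qed.

Lemma irreducible_weight_sum Lam (v : V) : irreducible_hw Lam v ->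
  forall u, weight_sum u.
Proof.
move=> [[_ irr] v0 vw _] u.
have [S0|->//] := irr _ weight_sum_submodule; exfalso; move/eqP: v0; apply.
suff : weight_sum v by rewrite S0.
exists [:: (inF Lam, v)]; last by rewrite big_seq1.
by move=> p; rewrite inE => /eqP ->.
Qed.
End Independence.
End FormalGroup.

Section CartanAlgebra.
Variables (F : fieldType) (n : nat) (A : 'M[int]_n) (alpha : 'M[int]_(n, dimH A)).
Variable D : cartan_datum F alpha.

Notation P := 'rV[int]_(dimH A).
Notation fh := 'rV[F]_(dimH A).
Notation L := (L D).

Definition rdual_dual (V : gmod F alpha) (phi : rdual V) : fdual V :=
  (rdual_fun phi : {linear V -> F^o}).

Definition hprod_fun Lam N (phi : rdual (L Lam)) (psi : rdual (L N)) :
    L (Lam + N) -> F^o :=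
  fun u => (Phi u : tens (L Lam) (L N)) (rdual_dual phi) (rdual_dual psi).

Lemma weight_tensor (V W : gmod F alpha) lam mu (v : V) (w : W) :
  weight_space V lam v -> weight_space W mu w ->
  weight_space (tens_gmod V W) (lam + mu) (tensor v w).
Proof.
move=> vl wm h; rewrite [LHS]tens_act_tensor vl wm pairingDl scalerDl.
by rewrite tensorZl tensorZr.
Qed.

Lemma hprod_supp (V W : gmod F alpha) (phi : fdual V) (psi : fdual W) (t : tens V W) mu :
  (forall v : V, weight_sum v) -> (forall w : W, weight_sum w) ->
  weight_space (tens_gmod V W) mu t -> t phi psi != 0 ->
  exists v w lam nu, [/\ weight_space V lam v, phi v != 0, weight_space W nu w,
    psi w != 0 & mu = lam + nu].
Proof.
move=> sV sW tmu tn0.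
pose good (p : (fh * V) * (fh * W)) :=
  weight_space V p.1.1 p.1.2 /\ weight_space W p.2.1 p.2.2.
have [s [gs ts]] : exists s : seq ((fh * V) * (fh * W)),
    (forall p, p \in s -> good p) /\ t = \sum_(p <- s) tensor p.1.2 p.2.2.
  elim/tens_ind: t {tmu tn0} => [|v w t [s [gs ->]]].
    by exists [::]; split; rewrite ?big_nil.
  have [r wr ->] := sV v; have [q wq ->] := sW w.
  exists ([seq (a, b) | a <- r, b <- q] ++ s); split.
    by move=> p; rewrite mem_cat => /orP[/allpairsP[[a b] /= [ar bq ->]]|/gs//];
       split; [exact: wr|exact: wq].
  rewrite big_cat big_allpairs; congr (_ + _).
  have suml (u : W) : tensor (\sum_(a <- r) a.2) u = \sum_(a <- r) tensor a.2 u.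
    elim: r {wr} => [|a r IH]; last by rewrite !big_cons tensorDl IH.
    by rewrite !big_nil -(scale0r (0 : V)) tensorZl scale0r.
  rewrite suml; apply: eq_bigr => a _.
  elim: q {wq} => [|b q IH]; last by rewrite !big_cons tensorDr IH.
  by rewrite !big_nil -(scale0r (0 : W)) tensorZr scale0r.
pose s' : seq (fh * tens_gmod V W) :=
  [seq (p.1.1 + p.2.1, tensor p.1.2 p.2.2) | p <- s].
have ws' : weighted s'.
  by move=> _ /mapP[p /gs[p1 p2] ->]; exact: weight_tensor.
have := weighted_sum ws' tmu; rewrite !big_map /= -ts => /(_ erefl) tE.
have evE (r : seq ((fh * V) * (fh * W))) (Q : pred _) :
    (\sum_(p <- r | Q p) tensor p.1.2 p.2.2 : tens V W) phi psi =
    \sum_(p <- r | Q p) phi p.1.2 * psi p.2.2.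
  elim: r => [|p r IH]; first by rewrite !big_nil.
  by rewrite !big_cons; case: ifP => // _; rewrite tensD IH.
move: tn0; rewrite -tE evE big_seq_cond => nz.
have /hasP[p ps /and3P[/eqP pmu p1 p2]] :
    has (fun p => [&& p.1.1 + p.2.1 == mu, phi p.1.2 != 0 & psi p.2.2 != 0]) s.
  apply: contraNT nz => /hasPn no; apply/eqP/big1 => p /andP[pin pm]; have := no _ pin.
  by rewrite pm /= negb_and !negbK => /orP[] /eqP ->; rewrite ?mul0r ?mulr0.
have [g1 g2] := gs _ ps.
by exists p.1.2, p.2.2, p.1.1, p.2.1.
Qed.

Fact hprod_subproof Lam N (phi : rdual (L Lam)) (psi : rdual (L N)) :
  rdual_pred (hprod_fun phi psi).
Proof.
apply/asboolP; split; first by move=> c u w; rewrite /hprod_fun Phi_linear.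
have [fphi fpsi] := (rdual_finite phi, rdual_finite psi).
apply: (sub_finite_set _ (finite_image2 (fun a b => a + b) fphi fpsi)).
move=> mu [u umu]; have ws M := irreducible_weight_sum (hwvP D M).
have wPhi : weight_space (tens_gmod (L Lam) (L N)) mu (Phi u).
  move=> h; rewrite -Phi_equivariant umu.
  have Phi0 : Phi (0 : L (Lam + N)) = 0.
    have := Phi_linear (-1) (0 : L (Lam + N)) 0.
    by rewrite scaleN1r oppr0 addr0 scaleN1r addNr.
  by rewrite -(addr0 (_ *: u)) Phi_linear Phi0 addr0.
move=> /(hprod_supp (ws _) (ws _) wPhi)[v [w [lam [nu [vl v0 wn w0 ->]]]]].
by exists lam; [exists v|exists nu; [exists w|]].
Qed.

Definition hprod Lam N (phi : rdual (L Lam)) (psi : rdual (L N)) :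
  rdual (L (Lam + N)) := Rdual (hprod_subproof phi psi).

(* An element of CA is a family of forms a_Lam on the L(Lam), almost all of them
   zero; the family is stored as one function on the disjoint union of the L(Lam). *)
Definition total := {Lam : Pplus A & L Lam}.
Notation inj Lam u := (Tagged (fun Lam => GRing.Lmodule.sort (gsort (L Lam))) (u : L Lam) : total).

Definition degrees (a : total -> F^o) : set (Pplus A) :=
  [set Lam | exists u : L Lam, a (inj Lam u) != 0].

Definition CA_pred (a : total -> F^o) : bool :=
  `[< (forall Lam, rdual_pred (fun u : L Lam => a (inj Lam u))) /\
      finite_set (degrees a) >].

Fact CA_closed : GRing.submod_closed CA_pred.
Proof.
split.
  apply/asboolP; split.
    by move=> Lam; have [r0 _] := rdual_closed (L Lam); exact: r0.
  by apply: (sub_finite_set _ (finite_set0 _)) => Lam [u /eqP].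
move=> c a b /asboolP[ra fa] /asboolP[rb fb]; apply/asboolP; split.
  move=> Lam; have [_ cl] := rdual_closed (L Lam).
  exact: (cl c _ _ (ra Lam) (rb Lam)).
apply: (sub_finite_set _ (_ : finite_set (degrees a `|` degrees b))); last first.
  by rewrite finite_setU.
move=> Lam [u]; have [au0|au0 _] := eqVneq (a (inj Lam u)) 0; last by left; exists u.
have -> : (c *: a + b) (inj Lam u) = c *: a (inj Lam u) + b (inj Lam u) by [].
by rewrite au0 scaler0 add0r; right; exists u.
Qed.

Record CA := MkCA { CA_fun :> total -> F^o; _ : CA_pred CA_fun }.
HB.instance Definition _ := [isSub for CA_fun].
HB.instance Definition _ := [Choice of CA by <:].
HB.instance Definition _ := GRing.SubChoice_isSubLmodule.Build F _ _ CA CA_closed.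

Fact CA_comp_subproof (a : CA) Lam : rdual_pred (fun u : L Lam => a (inj Lam u)).
Proof. by case: a => a /= /asboolP[+ _]; apply. Qed.

Definition CA_comp (a : CA) Lam : rdual (L Lam) := Rdual (CA_comp_subproof a Lam).

Definition CA_in_fun Lam (phi : rdual (L Lam)) : total -> F^o :=
  untag 0 (phi : L Lam -> F^o).

Lemma CA_in_funE Lam (phi : rdual (L Lam)) u : CA_in_fun phi (inj Lam u) = phi u.
Proof. by rewrite /CA_in_fun (untagE _ _ (erefl : tag (inj Lam u) = Lam)). Qed.

Lemma CA_in_funN Lam (phi : rdual (L Lam)) M u : M != Lam ->
  CA_in_fun phi (inj M u) = 0.
Proof. by move=> ne; rewrite /CA_in_fun untag_dflt. Qed.

Fact CA_in_subproof Lam (phi : rdual (L Lam)) : CA_pred (CA_in_fun phi).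
Proof.
apply/asboolP; split=> [M|].
  have [->|ne] := eqVneq M Lam.
    rewrite (_ : (fun _ => _) = phi); first exact: valP.
    by apply/funext => u; rewrite CA_in_funE.
  rewrite (_ : (fun _ => _) = 0); first by have [] := rdual_closed (L M).
  by apply/funext => u; rewrite CA_in_funN.
apply: (sub_finite_set _ (finite_set1 Lam)) => M [u].
by have [//|ne] := eqVneq M Lam; rewrite CA_in_funN // eqxx.
Qed.

Definition CA_in Lam (phi : rdual (L Lam)) : CA := MkCA (CA_in_subproof phi).

Definition CA_mul (a b : CA) : CA :=
  \sum_(Lam \in degrees a) \sum_(N \in degrees b)
    CA_in (hprod (CA_comp a Lam) (CA_comp b N)).
End CartanAlgebra.

Section ProjCA.
Variables (F : fieldType) (n : nat) (A : 'M[int]_n) (alpha : 'M[int]_(n, dimH A)).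
Variable D : cartan_datum F alpha.

Notation CA := (CA D).
Notation L := (L D).

Record ideal (I : set CA) : Prop := Ideal {
  ideal0 : I 0;
  idealB : forall a b, I a -> I b -> I (a - b);
  idealMl : forall a b, I b -> I (CA_mul a b);
  idealMr : forall a b, I a -> I (CA_mul a b) }.

Definition homogeneous (I : set CA) : Prop :=
  forall a Lam, I a -> I (CA_in (CA_comp a Lam)).

Definition homogeneous_ideal (I : set CA) : Prop := ideal I /\ homogeneous I.

Definition prime_ideal (I : set CA) : Prop :=
  I <> setT /\ forall a b, I (CA_mul a b) -> I a \/ I b.

Definition Proj_pred (Q : set CA) : bool := `[< homogeneous_ideal Q /\ prime_ideal Q >].

Record Proj := MkProj { Proj_set :> set CA; _ : Proj_pred Proj_set }.
HB.instance Definition _ := [isSub for Proj_set].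
HB.instance Definition _ := [Choice of Proj by <:].

Lemma ProjP (Q : Proj) : homogeneous_ideal Q /\ prime_ideal Q.
Proof. by case: Q => Q /= /asboolP. Qed.

Definition vanishing (I : set CA) : set Proj := [set Q : Proj | I `<=` Q].

Definition Proj_open : set_system Proj :=
  [set U | exists2 I, homogeneous_ideal I & U = ~` vanishing I].

Fact Proj_openT : Proj_open setT.
Proof.
exists setT; first by split.
apply/seteqP; split=> // Q _ QT; have [_ [+ _]] := ProjP Q; apply.
by apply/seteqP; split.
Qed.

Fact Proj_openI : setI_closed Proj_open.
Proof.
move=> _ _ [I [iI hI] ->] [J [iJ hJ] ->]; exists (I `&` J).
  split; last by move=> a Lam [Ia Ja]; split; [exact: hI|exact: hJ].
  split; first by split; exact: ideal0.
  - by move=> a b [? ?] [? ?]; split; exact: idealB.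
  - by move=> a b [? ?]; split; exact: idealMl.
  - by move=> a b [? ?]; split; exact: idealMr.
rewrite -setCU; congr (~` _); apply/seteqP; split=> Q.
  by move=> [IQ|JQ] a [Ia Ja]; [exact: IQ|exact: JQ].
move=> IJQ; have [_ [_ pQ]] := ProjP Q; apply: contrapT => /not_orP[].
move=> /existsNP[a /not_implyP[Ia nQa]] /existsNP[b /not_implyP[Jb nQb]].
have /IJQ/pQ[] // : (I `&` J) (CA_mul a b).
by split; [exact: idealMr|exact: idealMl].
Qed.

Fact Proj_open_bigU (T : Type) (f : T -> set Proj) :
  (forall i, Proj_open (f i)) -> Proj_open (\bigcup_i f i).
Proof.
move=> fo; have /boolp.choice[I IP] :
    forall i, exists I, homogeneous_ideal I /\ f i = ~` vanishing I.
  by move=> i; have [I hI fI] := fo i; exists I.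
have [hI fI] := all_and2 IP.
pose S : set CA := [set a | forall K, homogeneous_ideal K ->
  (forall i, I i `<=` K) -> K a].
exists S.
  split; last by move=> a Lam Sa K hK IK; apply: hK.2; exact: Sa.
  split; first by move=> K [iK _] _; exact: ideal0.
  - by move=> a b Sa Sb K hK IK; apply: idealB; [exact: hK.1|exact: Sa|exact: Sb].
  - by move=> a b Sb K hK IK; apply: idealMl; [exact: hK.1|exact: Sb].
  - by move=> a b Sa K hK IK; apply: idealMr; [exact: hK.1|exact: Sa].
rewrite (eq_bigcupr (fun i _ => fI i)) -setC_bigcap; congr (~` _).
apply/seteqP; split=> Q /=.
  by move=> IQ a; apply; [have [] := ProjP Q|move=> i; exact: IQ].
by move=> SQ i _ a Ia; apply: SQ => K _ IK; exact: (IK i).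
Qed.

HB.instance Definition _ :=
  isOpenTopological.Build Proj Proj_openT Proj_openI Proj_open_bigU.

(* Every L(Lam)^( * ) is an object of the category, so the second case does not
   occur. *)
Definition act_rdual (eta : natend F alpha) (V : gmod F alpha) (phi : rdual V) :
    rdual V :=
  if pselect (Oint (rdual_gmod V)) is left OV then eta (OintMod OV) phi else phi.

(* L(Lam)_f is the full dual of L(Lam)^( * ), with the contragredient action. *)
Definition act_Lf (g : Gfn F alpha) (V : gmod F alpha) (xi : rdual V -> F) :
    rdual V -> F :=
  fun phi => xi (act_rdual (Gfn_inverse g) phi).

(* (pi(g) phi)(v) = phi(g v): v is in L(Lam)_f as the form psi |-> psi v, and phi
   takes the value w(phi) at w in L(Lam)_f. *)
Definition pi_hom (g : Gfn F alpha) (V : gmod F alpha) (phi : rdual V) : rdual V :=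
  act_rdual (Gfn_inverse g) phi.

Lemma pi_homE g (V : gmod F alpha) (phi : rdual V) (v : V) :
  pi_hom g phi v = act_Lf g (fun psi => psi v) phi.
Proof. by []. Qed.

Lemma natend0 (eta : natend F alpha) V : eta V 0 = 0.
Proof.
have := @nat_linear _ _ _ _ eta V (-1) 0 0.
by rewrite scaleN1r oppr0 addr0 scaleN1r addNr.
Qed.

Lemma act_rdual0 eta V : act_rdual eta (0 : rdual V) = 0.
Proof.
rewrite /act_rdual; case: pselect => // OV.
exact: (natend0 eta (OintMod OV)).
Qed.

Definition CA_pi_fun (g : Gfn F alpha) (a : CA) : total D -> F^o :=
  fun x => pi_hom g (CA_comp a (tag x)) (tagged x).

Fact CA_pi_subproof g (a : CA) : CA_pred (CA_pi_fun g a).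
Proof.
apply/asboolP; split=> [Lam|].
  rewrite (_ : (fun _ => _) = pi_hom g (CA_comp a Lam)); first exact: valP.
  exact/funext.
have fa : finite_set (degrees a) by case: (a) => b /= /asboolP[].
apply: (sub_finite_set _ fa) => Lam [u nz]; apply: contrapT => na.
have a0 : CA_comp a Lam = 0.
  apply: rdualP => w /=; apply: contrapT => /eqP nw; apply: na; by exists w.
by move: nz; rewrite /CA_pi_fun /= a0 /pi_hom act_rdual0 eqxx.
Qed.

Definition CA_pi (g : Gfn F alpha) (a : CA) : CA := MkCA (CA_pi_subproof g a).

(* direct sum over Lam of the subspaces S Lam of L(Lam)^( * ) *)
Definition dsum (S : forall Lam : Pplus A, set (rdual (L Lam))) : set CA :=
  [set a | forall Lam, S Lam (CA_comp a Lam)].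

Definition in_facet (J : {set 'I_n}) (Lam : Pplus A) : Prop :=
  closed_facet J (Lam : 'rV[int]_(dimH A)).

Definition rdual_ne (Lam : Pplus A) : set (rdual (L Lam)) :=
  [set phi | forall u : L Lam, weight_space (L Lam) (inF F Lam) u -> phi u = 0].

Definition PJ (J : {set 'I_n}) : set CA :=
  dsum (fun Lam => [set phi | in_facet J Lam -> rdual_ne phi]).

(* the sum of the L(Lam)^( * ) over all Lam outside the closed facet of J *)
Definition IJ (J : {set 'I_n}) : set CA :=
  dsum (fun Lam => [set phi | in_facet J Lam -> phi = 0]).

Definition Or_bar (J : {set 'I_n}) : set Proj := vanishing (IJ J).

Definition Or (J : {set 'I_n}) : set Proj :=
  Or_bar J `\` \bigcup_(K in [set K : {set 'I_n} | J \proper K]) Or_bar K.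

Definition Proj_act (g : Gfn F alpha) (Q : set CA) : set CA := CA_pi g @^-1` Q.
End ProjCA.
Arguments PJ {F n A alpha} D J.
Arguments IJ {F n A alpha} D J.
Arguments Or_bar {F n A alpha} D J.
Arguments Or {F n A alpha} D J.

(* Main.v *)
Require Import Defs.
From mathcomp Require Import all_boot all_order all_algebra.
From mathcomp Require Import all_classical all_reals all_analysis.
From mathcomp Require Import ring zify.

(* Everything reduces to two facts about the forms on the L(Lam).

   Products of nonzero forms are nonzero: each f_i acts on the restricted duals as a
   locally nilpotent derivation of the product, so in characteristic 0 one can apply
   f_i^(p+q) with p and q maximal and descend until both forms are nonzero on the
   highest weight vectors, where the product is the product of the two values.  Hence
   the ideals defining the closures are prime, and each is the generic point of its
   stratum.

   Elements of the group are group-like: they commute with every equivariant bilinear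
   map of integrable objects, because exponentials of locally nilpotent derivations
   do.  For this the restricted duals must lie in the category, and the real root
   vectors are locally nilpotent on them because, by sl_2-theory, the weights of
   L(Lam) are stable under the Weyl group.

   Disjointness of the strata holds because a weight outside the facet of the union of
   J and K lies outside the facet of J or outside that of K. *)

Set Implicit Arguments.
Unset Strict Implicit.
Unset Printing Implicit Defensive.

Import Order.TTheory GRing.Theory Num.Theory.
Local Open Scope classical_set_scope.
Local Open Scope ring_scope.

(** Objects of the category have weights in finitely many cones mu + Q^+, so the restricted duals,
    with weights in -Lam + Q^+, are its natural members and the f_i are the operators that run out
    of room. One number, the length of a word in the f_i, controls the finiteness of the sums over
    n_f^-, the nilpotency of its elements and the descent in the Cartan product. It is well defined
    on weights because the simple roots are linearly independent.

    Group-likeness is phrased through bilinear maps between three objects, so a tensor product never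
    has to be placed in the category; the Cartan product of forms is itself such a map.

    Primality is required for arbitrary elements, whereas nonvanishing of products concerns
    homogeneous ones, and the degrees carry no ready-made order. An additive integer functional,
    injective on the finitely many degrees involved, replaces the order and allows a leading-term
    argument modulo a graded subspace. The ideals P(J) are prime for a simpler reason: evaluation at
    highest weight vectors is multiplicative. *)

Section LinearFunctions.
Variable F : fieldType.

Lemma linear_fun0 (V W : lmodType F) (f : V -> W) : linear f -> f 0 = 0.
Proof. by move=> lf; have := lf (-1) 0 0; rewrite scaleN1r oppr0 addr0 scaleN1r addNr. Qed.

Lemma linear_funD (V W : lmodType F) (f : V -> W) : linear f -> {morph f : x y / x + y}.
Proof. by move=> lf x y; rewrite -[x]scale1r lf !scale1r. Qed.

Lemma linear_funZ (V W : lmodType F) (f : V -> W) c x : linear f -> f (c *: x) = c *: f x.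
Proof. by move=> lf; rewrite -[c *: x]addr0 lf (linear_fun0 lf) addr0. Qed.

Lemma linear_fun_sum (V W : lmodType F) (f : V -> W) I (r : seq I) (Q : pred I) (G : I -> V) :
  linear f -> f (\sum_(i <- r | Q i) G i) = \sum_(i <- r | Q i) f (G i).
Proof. by move=> lf; apply: (big_morph f (linear_funD lf) (linear_fun0 lf)). Qed.

Lemma iter_linear0 (V : lmodType F) (f : V -> V) k : linear f -> iter k f 0 = 0.
Proof. by move=> lf; elim: k => //= k ->; exact: linear_fun0. Qed.

Lemma iter_linear_leq0 (V : lmodType F) (f : V -> V) k m u :
  linear f -> (k <= m)%N -> iter k f u = 0 -> iter m f u = 0.
Proof. by move=> lf km; rewrite -(subnK km) iterD => ->; exact: iter_linear0. Qed.

Lemma iter_linear (V : lmodType F) (f : V -> V) k : linear f -> linear (iter k f).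
Proof. by move=> lf; elim: k => // k IH c u w; rewrite !iterS IH lf. Qed.

(** Induction on the list: pass to the kernel of the first form and add one vector of [S] on which
    that form is nonzero. It will bound weight spaces of restricted duals, the forms being
    evaluations at words. *)
Lemma separating_finite_span (V : lmodType F) (ls : seq (V -> F^o)) (S : set V) :
  (forall l, l \in (ls : seq (V -> F^o)) -> linear l) ->
  (forall c u w, S u -> S w -> S (c *: u + w)) ->
  (forall u, S u -> (forall l, l \in ls -> l u = 0) -> u = 0) ->
  exists s : seq V, forall u, S u -> exists c : nat -> F, u = \sum_(k < size s) c k *: s`_k.
Proof.
elim: ls S => [|l ls IH] S lin cl sep.
  exists [::] => u Su; exists (fun=> 0); rewrite big_ord0; exact: sep.
have ll : linear l by apply: lin; rewrite mem_head.
have lls m : m \in ls -> linear m by move=> mls; apply: lin; rewrite inE mls orbT.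
have [s sP] : exists s : seq V, forall u, (S u /\ l u = 0) ->
    exists c : nat -> F, u = \sum_(k < size s) c k *: s`_k.
  apply: (IH [set u | S u /\ l u = 0]) => //.
    by move=> c u w [Su lu] [Sw lw]; split; [exact: cl|rewrite ll lu lw scaler0 addr0].
  by move=> u [Su lu] lsu; apply: sep => // m; rewrite inE => /orP[/eqP ->|/lsu].
have [[u0 [Su0 lu0]]|no] := pselect (exists u0, S u0 /\ l u0 != 0); last first.
  by exists s => u Su; apply: sP; split => //; apply/eqP; apply: contrapT => /negP lu; apply: no; exists u.
exists (u0 :: s) => u Su.
have [c cE] : exists c : nat -> F, (- (l u / l u0)) *: u0 + u = \sum_(k < size s) c k *: s`_k.
  apply: sP; split; first exact: cl.
  by rewrite ll scaleNr; apply/eqP; rewrite addrC subr_eq0; apply/eqP/esym; exact: divfK.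
exists (fun k => if k is k'.+1 then c k' else l u / l u0).
by rewrite big_ord_recl /= -cE scaleNr addrA subrr add0r.
Qed.
End LinearFunctions.

(** * Weights and the height function *)

Section Weights.
Variables (F : fieldType) (n : nat) (A : 'M[int]_n) (alpha : 'M[int]_(n, dimH A)).
Hypothesis charF : [pchar F] =i pred0.
Hypothesis real_alpha : realization alpha.

Notation P := 'rV[int]_(dimH A).
Notation fh := 'rV[F]_(dimH A).
Notation alpha_ := (simple_root alpha).
Notation inF := (inF F).

Lemma natr_eq0_char0 m : ((m%:R : F) == 0) = (m == 0)%N.
Proof. exact: (iffLR (@pcharf0P F) charF). Qed.

Lemma intr_inj_char0 : injective (intr : int -> F).
Proof.
move=> a b /eqP; rewrite -subr_eq0 -rmorphB /= => /eqP ab0.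
apply/eqP; rewrite -subr_eq0; move: (a - b) ab0 => [m|m].
  by move/eqP; rewrite natr_eq0_char0 => /eqP ->.
by move/eqP; rewrite NegzE mulrNz oppr_eq0 natr_eq0_char0.
Qed.

Lemma inF_inj : injective (@Defs.inF F n A).
Proof.
move=> x y /rowP e; apply/rowP => k; move: (e k); rewrite !mxE.
exact: intr_inj_char0.
Qed.

Lemma inFD (x y : P) : inF (x + y) = inF x + inF y.
Proof. exact: map_mxD. Qed.
Lemma inFB (x y : P) : inF (x - y) = inF x - inF y.
Proof. exact: map_mxB. Qed.
Lemma inFN (x : P) : inF (- x) = - inF x.
Proof. exact: map_mxN. Qed.

Lemma pairing_hI (R : pzRingType) (lam : 'rV[R]_(dimH A)) i :
  pairing lam (hI A R i) = lam 0 (lshift _ i).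
Proof.
rewrite /pairing (bigD1 (lshift _ i)) //= big1 => [|j jk]; rewrite !mxE ?eqxx ?mulr1 ?addr0 //.
by rewrite (negPf jk) andbF mulr0.
Qed.

Lemma pairing_inF (lam : P) i :
  pairing (inF lam) (hI A F i) = (pairing lam (hI A int i))%:~R.
Proof. by rewrite !pairing_hI !mxE. Qed.

Lemma pairingNl (R : pzRingType) (x h : 'rV[R]_(dimH A)) : pairing (- x) h = - pairing x h.
Proof. by rewrite /pairing -sumrN; apply: eq_bigr => k _; rewrite mxE mulNr. Qed.

Lemma pairingZl (R : pzRingType) c (x h : 'rV[R]_(dimH A)) : pairing (c *: x) h = c * pairing x h.
Proof. by rewrite /pairing mulr_sumr; apply: eq_bigr => k _; rewrite mxE mulrA. Qed.

Lemma pairingBl (R : pzRingType) (x y h : 'rV[R]_(dimH A)) :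
  pairing (x - y) h = pairing x h - pairing y h.
Proof. by rewrite pairingDl pairingNl. Qed.

Definition wsum (w : seq 'I_n) : P := \sum_(i <- w) alpha_ i.

(** Independence of the simple roots gives a rational right inverse B of [alpha]; the coordinate sum
    of x B is additive and equals 1 on each simple root. Off the root lattice it need not be an
    integer, hence [rat]. *)
Lemma height_exists : exists ht : P -> rat,
  (forall x y, ht (x + y) = ht x + ht y) /\ (forall w, ht (wsum w) = (size w)%:R).
Proof.
have [/row_freeP[B BP] _] := real_alpha.
pose ht (x : P) : rat := ((map_mx intr x : 'rV[rat]__) *m B *m const_mx 1 : 'M[rat]_1) 0 0.
have htD x y : ht (x + y) = ht x + ht y by rewrite /ht map_mxD !mulmxDl mxE.
exists ht; split => // w; rewrite /wsum.
elim: w => [|i w IH]; first by rewrite big_nil /ht map_mx0 !mul0mx mxE.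
rewrite big_cons htD IH /= -natr1 addrC; congr (_ + _).
rewrite /ht /simple_root map_row -row_mul BP -row_mul mul1mx !mxE; exact: erefl.
Qed.

End Weights.

(** * Modules spanned by words in the lowering operators *)

Section Words.
Variables (F : fieldType) (n : nat) (A : 'M[int]_n) (alpha : 'M[int]_(n, dimH A)).
Hypothesis charF : [pchar F] =i pred0.
Hypothesis real_alpha : realization alpha.

Notation P := 'rV[int]_(dimH A).
Notation fh := 'rV[F]_(dimH A).
Notation alpha_ := (simple_root alpha).
Notation inF := (inF F).
Notation wsum := (wsum alpha).
Notation gmod := (gmod F alpha).
Notation e_ := (km_e F alpha).
Notation f_ := (km_f F alpha).
Notation h_ := (km_h alpha).

Lemma wsum_nil : wsum [::] = 0. Proof. exact: big_nil. Qed.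
Lemma wsum_cons i w : wsum (i :: w) = alpha_ i + wsum w. Proof. exact: big_cons. Qed.
Lemma wsum_cat w w' : wsum (w ++ w') = wsum w + wsum w'. Proof. exact: big_cat. Qed.

Lemma wsum_size (w w' : seq 'I_n) : wsum w = wsum w' -> size w = size w'.
Proof.
have [ht [_ htw]] := height_exists real_alpha.
by move=> /(congr1 ht); rewrite !htw => /eqP; rewrite eqr_nat => /eqP.
Qed.

Lemma wsum_nseq i k : wsum (nseq k i) = alpha_ i *+ k.
Proof. by elim: k => [|k IH]; rewrite ?wsum_nil //= wsum_cons IH mulrS. Qed.

Lemma Qplus_wsum q : Qplus alpha q <-> exists w, q = wsum w.
Proof.
split=> [[k _ <-]|[w ->]].
  elim/big_ind: _ => [|x y [w ->] [w' ->]|i _]; first by exists [::]; rewrite wsum_nil.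
    by exists (w ++ w'); rewrite wsum_cat.
  by exists (nseq (k i) i); rewrite wsum_nseq.
elim: w => [|i w [k _ kw]].
  by exists (fun=> 0%N) => //; rewrite wsum_nil big1.
exists (fun j => (j == i) + k j)%N => //; rewrite wsum_cons -kw.
rewrite (eq_bigr (fun j => alpha_ j *+ (j == i) + alpha_ j *+ k j)); last first.
  by move=> j _; rewrite mulrnDr.
rewrite big_split /=; congr (_ + _).
by rewrite (bigD1 i) //= eqxx mulr1n big1 ?addr0 // => j /negPf ->.
Qed.

Variable V : gmod.

Definition fword (w : seq 'I_n) (u : V) : V := foldr (fun i => gact (f_ i)) u w.

Lemma fword_nseq i k u : fword (nseq k i) u = iter k (gact (f_ i)) u.
Proof. by elim: k => //= k ->. Qed.

Lemma weight_fword (M : P) (v : V) w : weight_space V (inF M) v ->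
  weight_space V (inF (M - wsum w)) (fword w v).
Proof.
move=> vM; elim: w => [|i w IH]; first by rewrite wsum_nil subr0.
by rewrite wsum_cons (addrC (alpha_ i)) opprD addrA inFB; exact: weight_f.
Qed.

Definition fspan (v : V) : set V :=
  [set u | exists s : seq (F * seq 'I_n), u = \sum_(p <- s) p.1 *: fword p.2 v].

Lemma fspan0 v : fspan v 0.
Proof. by exists [::]; rewrite big_nil. Qed.
Lemma fspanD v u u' : fspan v u -> fspan v u' -> fspan v (u + u').
Proof. by move=> [s ->] [s' ->]; exists (s ++ s'); rewrite big_cat. Qed.
Lemma fspanZ v c u : fspan v u -> fspan v (c *: u).
Proof.
move=> [s ->]; exists [seq (c * p.1, p.2) | p <- s].
by rewrite big_map scaler_sumr; apply: eq_bigr => p _; rewrite scalerA.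
Qed.
Lemma fspan_word v w : fspan v (fword w v).
Proof. by exists [:: (1, w)]; rewrite big_seq1 scale1r. Qed.

Lemma fspan_closed v (f : {linear V -> V}) :
  (forall w, fspan v (f (fword w v))) -> forall u, fspan v u -> fspan v (f u).
Proof.
move=> fw _ [s ->]; rewrite linear_sum; elim/big_ind: _ => [|x y|p _].
- exact: fspan0.
- exact: fspanD.
by rewrite linearZ; apply: fspanZ.
Qed.

(** Moving [e_i] through a word produces only elements of h, which act on words by scalars, until
    [e_i] reaches [v] and kills it. *)
Lemma fspan_submodule (v : V) (M : P) : weight_space V (inF M) v ->
  (forall i, gact (e_ i) v = 0) -> submodule (fspan v).
Proof.
move=> vM ev; split; first exact: fspan0.
  by move=> c u w Su Sw; apply: fspanD => //; exact: fspanZ.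
have Sh h u : fspan v u -> fspan v (gact (h_ h) u).
  apply: fspan_closed => w /=; rewrite (weight_fword w vM); apply: fspanZ.
  exact: fspan_word.
have Sf i u : fspan v u -> fspan v (gact (f_ i) u).
  by apply: fspan_closed => w; exact: (fspan_word v (i :: w)).
elim/km_ind => [i|i|h||x y Sx Sy|c x Sx|x y Sx Sy] u Su.
- apply: fspan_closed Su => {u} /=; elim=> [|j w IH] /=; first by rewrite ev; exact: fspan0.
  have := gact_bracket (e_ i) (f_ j) (fword w v).
  rewrite bracket_ef => /eqP; rewrite eq_sym subr_eq => /eqP -> /=.
  apply: fspanD; last exact: Sf.
  by case: eqP => _; [apply: Sh; exact: fspan_word|rewrite gact0l; exact: fspan0].
- exact: Sf.
- exact: Sh.
- by rewrite gact0l; exact: fspan0.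
- by rewrite gactDl; apply: fspanD; [exact: Sx|exact: Sy].
- by rewrite gactZl; apply: fspanZ; exact: Sx.
- rewrite gact_bracket -scaleN1r; apply: fspanD; first by apply/Sx/Sy.
  by apply/fspanZ/Sy/Sx.
Qed.

Lemma irreducible_fspan (v : V) (M : P) : irreducible_gmod V -> v != 0 ->
  weight_space V (inF M) v -> (forall i, gact (e_ i) v = 0) ->
  forall u, fspan v u.
Proof.
move=> [_ irr] v0 vM ev u.
have [S0|->//] := irr _ (fspan_submodule vM ev); exfalso; move/eqP: v0; apply.
by have := fspan_word v [::]; rewrite S0.
Qed.

Lemma fspan_weight (v : V) (M : P) mu u : weight_space V (inF M) v ->
  fspan v u -> weight_space V mu u ->
  exists s : seq (F * seq 'I_n), (forall p, p \in s -> inF (M - wsum p.2) = mu) /\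
    u = \sum_(p <- s) p.1 *: fword p.2 v.
Proof.
move=> vM [s us] umu.
have := @weighted_sum _ _ _ _ V [seq (inF (M - wsum p.2), p.1 *: fword p.2 v) | p <- s] mu u.
rewrite !big_map /= => /(_ _ umu (esym us)) <- => [|q /mapP[p _ ->] h /=].
  exists [seq p <- s | inF (M - wsum p.2) == mu]; rewrite big_filter; split => //.
  by move=> p; rewrite mem_filter => /andP[/eqP].
by rewrite linearZ /= (weight_fword _ vM) !scalerA mulrC.
Qed.

Lemma fspan_is_weight (v : V) (M : P) mu u : weight_space V (inF M) v ->
  fspan v u -> weight_space V mu u -> u != 0 -> exists w, mu = inF (M - wsum w).
Proof.
move=> vM vu umu u0; have [s [sP us]] := fspan_weight vM vu umu.
case: s sP us => [_ us|p s sP _]; first by rewrite us big_nil eqxx in u0.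
by exists p.2; rewrite sP // mem_head.
Qed.
End Words.

(** * Integrability of the highest weight modules *)

Section Integrability.
Variables (F : fieldType) (n : nat) (A : 'M[int]_n) (alpha : 'M[int]_(n, dimH A)).
Hypothesis charF : [pchar F] =i pred0.
Hypothesis gcmA : gcm A.
Hypothesis real_alpha : realization alpha.

Notation P := 'rV[int]_(dimH A).
Notation fh := 'rV[F]_(dimH A).
Notation alpha_ := (simple_root alpha).
Notation inF := (inF F).
Notation wsum := (wsum alpha).
Notation gmod := (gmod F alpha).
Notation e_ := (km_e F alpha).
Notation f_ := (km_f F alpha).
Notation h_ := (km_h alpha).
Notation g := (km F alpha).

Lemma bracketC (x y : g) : bracket x y = - bracket y x.
Proof.
apply/eqP; rewrite -addr_eq0; apply/eqP.
by have := bracketxx (x + y); rewrite bracketDl !bracketDr !bracketxx add0r addr0.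
Qed.
Lemma bracketNr (x y : g) : bracket x (- y) = - bracket x y.
Proof. by rewrite -scaleN1r bracketZr scaleN1r. Qed.
Lemma bracketNl (x y : g) : bracket (- x) y = - bracket x y.
Proof. by rewrite -scaleN1r bracketZl scaleN1r. Qed.
Lemma gactNl (V : gmod) x (u : V) : gact (- x) u = - gact x u.
Proof. by rewrite -scaleN1r gactZl scaleN1r. Qed.

Lemma gact_swap (V : gmod) (x y : g) (u : V) :
  gact x (gact y u) = gact (bracket x y) u + gact y (gact x u).
Proof. by rewrite gact_bracket subrK. Qed.

(** Since y x u = [y,x] u + x y u, each factor y is absorbed either by the bracket, lowering N, or
    by u, lowering K. *)
Lemma iter_gact_nilp (V : gmod) (y x : g) N K (u : V) : iter N (bracket y) x = 0 ->
  iter K (gact y) u = 0 -> iter (N + K) (gact y) (gact x u) = 0.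
Proof.
have [m] := ubnP (N + K)%N; elim: m N K x u => // m IH [|N] K x u lem.
  by move=> /= -> _; rewrite gact0l (iter_linear0 _ (gact_linear y)).
case: K lem => [|K] lem xN uK; first by rewrite /= in uK; rewrite uK linear0 (iter_linear0 _ (gact_linear y)).
rewrite addSn iterSr gact_swap.
have [r1 r2] : iter (N + K.+1) (gact y) (gact (bracket y x) u) = 0 /\
    iter (N + K.+1) (gact y) (gact x (gact y u)) = 0.
  split; first by apply: IH => //; rewrite -iterSr.
  by rewrite addnS -addSn; apply: IH; rewrite -?iterSr // addSnnS.
by rewrite (linear_funD (iter_linear _ (gact_linear y))) r1 r2 addr0.
Qed.

(** By [iter_gact_nilp], ad-nilpotency is needed on generators only, where the Serre relations
    provide it. In an irreducible module one nonzero nilpotent vector then makes all vectors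
    nilpotent. *)
Lemma nilp_submodule (V : gmod) (y : g) :
  (forall i, exists N, iter N (bracket y) (e_ i) = 0) ->
  (forall i, exists N, iter N (bracket y) (f_ i) = 0) ->
  (forall h, exists N, iter N (bracket y) (h_ h) = 0) ->
  submodule [set u : V | exists k, iter k (gact y) u = 0].
Proof.
move=> ne nf nh; set S := (X in submodule X).
have SP c u w : S u -> S w -> S (c *: u + w).
  move=> [k ku] [m mw]; exists (k + m)%N; rewrite (iter_linear _ (gact_linear y)).
  rewrite (iter_linear_leq0 (gact_linear y) _ ku) ?leq_addr // (iter_linear_leq0 (gact_linear y) _ mw) ?leq_addl //.
  by rewrite scaler0 addr0.
have S0 : S 0 by exists 0%N.
split => //; elim/km_ind => [i|i|h||x x' Sx Sx'|c x Sx|x x' Sx Sx'] u Su.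
- by have [N eN] := ne i; have [k uk] := Su; exists (N + k)%N; exact: iter_gact_nilp.
- by have [N eN] := nf i; have [k uk] := Su; exists (N + k)%N; exact: iter_gact_nilp.
- by have [N eN] := nh h; have [k uk] := Su; exists (N + k)%N; exact: iter_gact_nilp.
- by rewrite gact0l.
- by rewrite gactDl -(scale1r (gact x u)); apply: SP; [exact: Sx|exact: Sx'].
- by rewrite gactZl -[_ *: _]addr0; apply: SP => //; exact: Sx.
- rewrite gact_bracket addrC -scaleN1r; apply: SP; first by apply/Sx'/Sx.
  by apply/Sx/Sx'.
Qed.

Lemma pairing_alphaF i j : pairing (inF (alpha_ i)) (hI A F j) = (A j i)%:~R.
Proof. by rewrite pairing_inF real_alpha.2. Qed.

Lemma bracket_hei i : bracket (h_ (hI A F i)) (e_ i) = 2%:R *: e_ i.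
Proof. by rewrite bracket_he pairing_alphaF gcmA.1. Qed.
Lemma bracket_hfi i : bracket (h_ (hI A F i)) (f_ i) = - 2%:R *: f_ i.
Proof. by rewrite bracket_hf pairing_alphaF gcmA.1. Qed.

Lemma ad_nilp_f i (y := f_ i) :
  [/\ forall j, exists N, iter N (bracket y) (e_ j) = 0,
      forall j, exists N, iter N (bracket y) (f_ j) = 0 &
      forall h, exists N, iter N (bracket y) (h_ h) = 0].
Proof.
split=> j.
- have [->|ij] := eqVneq j i.
    (* ad f_i sends e_i to -h_i, then to a multiple of f_i, then to 0. *)
    exists 3%N; rewrite /= (bracketC y (e_ i)) bracket_ef eqxx bracketNr (bracketC y (h_ _)).
    by rewrite bracket_hfi !bracketNr bracketZr bracketxx scaler0 !oppr0.
  by exists 1%N; rewrite /= bracketC bracket_ef (negPf ij) oppr0.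
- have [->|ji] := eqVneq j i; first by exists 1%N; rewrite /= bracketxx.
  by exists `|1 - A i j|%N; rewrite eq_sym in ji; exact: serre_f.
- by exists 2%N; rewrite /= (bracketC y (h_ _)) bracket_hf bracketNr bracketZr bracketxx scaler0 oppr0.
Qed.

Lemma ad_nilp_e i (y := e_ i) :
  [/\ forall j, exists N, iter N (bracket y) (e_ j) = 0,
      forall j, exists N, iter N (bracket y) (f_ j) = 0 &
      forall h, exists N, iter N (bracket y) (h_ h) = 0].
Proof.
split=> j.
- have [->|ji] := eqVneq j i; first by exists 1%N; rewrite /= bracketxx.
  by exists `|1 - A i j|%N; rewrite eq_sym in ji; exact: serre_e.
- have [->|ij] := eqVneq j i.
    exists 3%N; rewrite /= bracket_ef eqxx (bracketC y (h_ _)).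
    by rewrite bracket_hei !bracketNr bracketZr bracketxx scaler0 !oppr0.
  by exists 1%N; rewrite /= bracket_ef eq_sym (negPf ij).
- by exists 2%N; rewrite /= (bracketC y (h_ _)) bracket_he bracketNr bracketZr bracketxx scaler0 oppr0.
Qed.

(** * Strings of an sl_2-triple *)

Section Sl2.
Variables (V : gmod) (x y h : g).
Hypotheses (xy : bracket x y = h) (hx : bracket h x = 2%:R *: x)
  (hy : bracket h y = - 2%:R *: y).

Lemma sl2_h_lower (u : V) m k : gact h u = m *: u ->
  gact h (iter k (gact y) u) = (m - 2%:R * k%:R) *: iter k (gact y) u.
Proof.
move=> hu; elim: k => [|k IH] /=; first by rewrite mulr0 subr0.
rewrite gact_swap hy gactZl IH linearZ /= -scalerDl; congr (_ *: _).
by rewrite -natr1; ring.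
Qed.

Lemma sl2_h_raise (u : V) m k : gact h u = m *: u ->
  gact h (iter k (gact x) u) = (m + 2%:R * k%:R) *: iter k (gact x) u.
Proof.
move=> hu; elim: k => [|k IH] /=; first by rewrite mulr0 addr0.
rewrite gact_swap hx gactZl IH linearZ /= -scalerDl; congr (_ *: _).
by rewrite -natr1; ring.
Qed.

Lemma sl2_raise_lower (u : V) m k : gact x u = 0 -> gact h u = m *: u ->
  gact x (iter k.+1 (gact y) u) = (k.+1%:R * (m - k%:R)) *: iter k (gact y) u.
Proof.
move=> xu hu; elim: k => [|k IH].
  by rewrite /= gact_swap xy xu linear0 addr0 hu mul1r subr0.
rewrite iterS gact_swap xy IH linearZ /= gact_swap hy gactZl (sl2_h_lower _ hu) linearZ /=.
rewrite -!scalerDl; congr (_ *: _); rewrite -!natr1; ring.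
Qed.

(** Let y^(r+1) be the first power that kills u. Applying x gives (r+1)(m-r) y^r u = 0, which in
    characteristic 0 forces m = r. *)
Lemma sl2_highest (u : V) m : (exists k, iter k (gact y) u = 0) -> u != 0 ->
  gact x u = 0 -> gact h u = m *: u ->
  exists2 r, m = r%:R & forall k, (k <= r)%N -> iter k (gact y) u != 0.
Proof.
move=> nil u0 xu hu.
have ex : exists k, iter k (gact y) u == 0 by have [k kP] := nil; exists k; exact/eqP.
case: (ex_minnP ex) => -[|r] /eqP r0 rmin; first by move: u0; rewrite /= in r0; rewrite r0 eqxx.
have nz k : (k <= r)%N -> iter k (gact y) u != 0.
  by move=> kr; apply: contraTneq kr => /eqP/rmin; rewrite -ltnNge.
exists r => //; have := sl2_raise_lower r xu hu; rewrite r0 linear0 => /esym/eqP.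
rewrite scaler_eq0 (negPf (nz r _)) // orbF mulf_eq0 natr_eq0_char0 //= subr_eq0.
by move/eqP.
Qed.

(** For p maximal, x^p u is a highest weight vector of weight m + 2p, so y^k does not kill it for k
    <= m + 2p. The choice k = m + p lands in weight -m, the reflection of m, without decomposing the
    sl_2-module. *)
Lemma sl2_string (u : V) m : (forall w : V, exists k, iter k (gact y) w = 0) ->
  (exists k, iter k (gact x) u = 0) -> u != 0 -> gact h u = m%:R *: u ->
  exists p, iter (m + p) (gact y) (iter p (gact x) u) != 0.
Proof.
move=> nily nilx u0 hu.
have ex : exists k, iter k (gact x) u == 0 by have [k kP] := nilx; exists k; exact/eqP.
case: (ex_minnP ex) => -[|p] /eqP p0 pmin; first by move: u0; rewrite /= in p0; rewrite p0 eqxx.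
have nz : iter p (gact x) u != 0 by apply/negP => /pmin; rewrite ltnn.
have [r /eqP rP nzr] := sl2_highest (nily _) nz p0 (sl2_h_raise p hu).
exists p; apply: nzr; move: rP; rewrite -natrM -natrD -subr_eq0.
have -> : (m + 2 * p)%:R - r%:R = ((Posz (m + 2 * p)) - Posz r)%:~R :> F.
  by rewrite rmorphB.
rewrite (inj_eq (@intr_inj_char0 _ charF) _ 0) subr_eq0 => /eqP[<-].
by rewrite leq_add2l mul2n -addnn leq_addr.
Qed.
End Sl2.

Lemma weight_iter_f (V : gmod) (lam : P) (u : V) i k : weight_space V (inF lam) u ->
  weight_space V (inF (lam - alpha_ i *+ k)) (iter k (gact (f_ i)) u).
Proof. by move=> ul; rewrite -fword_nseq -wsum_nseq; exact: weight_fword. Qed.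

Lemma weight_iter_e (V : gmod) (lam : P) (u : V) i k : weight_space V (inF lam) u ->
  weight_space V (inF (lam + alpha_ i *+ k)) (iter k (gact (e_ i)) u).
Proof.
move=> ul; elim: k => [|k IH]; first by rewrite mulr0n addr0.
by rewrite mulrSr addrA inFD; exact: weight_e.
Qed.

Lemma reflectionK i : involutive (reflection alpha i).
Proof.
move=> x; rewrite /reflection pairingBl.
rewrite pairingZl real_alpha.2 gcmA.1.
have -> : pairing x (hI A int i) - pairing x (hI A int i) * 2 = - pairing x (hI A int i) by ring.
by rewrite scaleNr opprK subrK.
Qed.

Lemma reflectionP i c x y :
  reflection alpha i (c *: x + y) = c *: reflection alpha i x + reflection alpha i y.
Proof.
rewrite /reflection pairingDl.
by rewrite pairingZl scalerDl opprD scalerBr scalerA addrACA.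
Qed.

Lemma wsum_eq0 w : wsum w = 0 -> w = [::].
Proof. by rewrite -(wsum_nil alpha) => /(wsum_size real_alpha)/size0nil. Qed.

Section HighestWeight.
Variables (V : gmod) (Lam : Pplus A) (v : V).
Hypothesis hwV : irreducible_hw Lam v.

Lemma hw_fspan u : fspan v u.
Proof. by case: hwV => irr v0 vL ev; apply: (irreducible_fspan irr v0 vL ev). Qed.

Lemma hw_weight mu u : weight_space V mu u -> u != 0 ->
  exists w, mu = inF ((Lam : P) - wsum w).
Proof. by case: hwV => irr v0 vL ev; apply: (fspan_is_weight vL); exact: hw_fspan. Qed.

(** With m = Lam(h_i), the vector f_i^(m+1) v is killed by every e_j. Were it nonzero, words in the
    f_j applied to it would span the module, and v would have a weight strictly below Lam. *)
Lemma hw_f_nilp_v i : exists k, iter k (gact (f_ i)) v = 0.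
Proof.
have [irr v0 vL ev] := hwV.
have /forallP/(_ i) : dominant (Lam : P) by case: (Lam).
case E: (pairing _ _) => [m|//] _; exists m.+1.
set w := iter _ _ _; apply: contrapT => /eqP w0.
have wL : weight_space V (inF ((Lam : P) - alpha_ i *+ m.+1)) w by exact: weight_iter_f.
have ew j : gact (e_ j) w = 0.
  have [->|ji] := eqVneq j i.
    rewrite (@sl2_raise_lower _ _ _ (h_ (hI A F i)) _ _ _ m%:R) ?subrr ?mulr0 ?scale0r //.
    - by rewrite bracket_ef eqxx.
    - exact: bracket_hfi.
    - by rewrite vL pairing_inF E.
  rewrite /w; elim: m.+1 => [|k IH] /=; first exact: ev.
  by rewrite gact_swap bracket_ef (negPf ji) gact0l IH linear0 addr0.
have [t] := fspan_is_weight wL (irreducible_fspan irr w0 wL ew v) vL v0.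
move/(inF_inj charF)/eqP; rewrite -addrA -subr_eq0 opprD addrA subrr add0r -opprD opprK.
by rewrite -wsum_nseq -wsum_cat => /eqP/wsum_eq0.
Qed.

Lemma hw_nilp y : 
  [/\ forall j, exists N, iter N (bracket y) (e_ j) = 0,
      forall j, exists N, iter N (bracket y) (f_ j) = 0 &
      forall h, exists N, iter N (bracket y) (h_ h) = 0] ->
  (exists k, iter k (gact y) v = 0) -> forall u : V, exists k, iter k (gact y) u = 0.
Proof.
move=> [ne nf nh] vk u; have [[_ irr] v0 _ _] := hwV.
have [S0|ST] := irr _ (nilp_submodule V ne nf nh).
  exfalso; move/eqP: v0; apply; have : [set 0] v by rewrite -S0.
  by [].
have : [set: V] u by []. by rewrite -ST.
Qed.

Lemma hw_f_nilp i u : exists k, iter k (gact (f_ i)) u = 0 :> V.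
Proof. by apply: hw_nilp; [exact: ad_nilp_f|exact: hw_f_nilp_v]. Qed.
Lemma hw_e_nilp i u : exists k, iter k (gact (e_ i)) u = 0 :> V.
Proof.
apply: hw_nilp; first exact: ad_nilp_e.
by exists 1%N; case: hwV => _ _ _ /=.
Qed.

Lemma hw_weight_reflection i (lam : P) : is_weight V lam -> is_weight V (reflection alpha i lam).
Proof.
move=> [u ul u0]; rewrite /reflection; case E: (pairing _ _) => [m|m].
  have [|||||||p nz] := @sl2_string V (e_ i) (f_ i) (h_ (hI A F i)) _ _ _ u m.
  - by rewrite bracket_ef eqxx.
  - exact: bracket_hei.
  - exact: bracket_hfi.
  - exact: hw_f_nilp.
  - exact: hw_e_nilp.
  - exact: u0.
  - by rewrite ul pairing_inF E.
  exists (iter (m + p) (gact (f_ i)) (iter p (gact (e_ i)) u)) => //.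
  have := weight_iter_f i (m + p) (weight_iter_e i p ul).
  by rewrite mulrnDr opprD addrACA subrr addr0 -natz scaler_nat.
(* The value -(m+1) on h_i becomes positive for the triple (f_i, e_i, -h_i). *)
have [|||||||p nz] := @sl2_string V (f_ i) (e_ i) (- h_ (hI A F i)) _ _ _ u m.+1.
- by rewrite bracketC bracket_ef eqxx.
- by rewrite bracketNl bracket_hfi scaleNr opprK.
- by rewrite bracketNl bracket_hei scaleNr.
- exact: hw_e_nilp.
- exact: hw_f_nilp.
- exact: u0.
- by rewrite gactNl ul pairing_inF E NegzE mulrNz scaleNr opprK.
exists (iter (m.+1 + p) (gact (e_ i)) (iter p (gact (f_ i)) u)) => //.
have := weight_iter_e i (m.+1 + p) (weight_iter_f i p ul).
by rewrite NegzE scaleNr opprK mulrnDr addrACA addNr addr0 -natz scaler_nat.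
Qed.

(* Real root strings through a weight are finite because the set of weights is
   stable under the Weyl group and bounded above along each simple root. *)
Lemma hw_real_string b : real_roots alpha b \/ real_roots alpha (- b) ->
  forall lam : P, exists N, forall k, is_weight V (lam + b *+ k) -> (k <= N)%N.
Proof.
pose bnd b := forall lam : P, exists N, forall k, is_weight V (lam + b *+ k) -> (k <= N)%N.
have refl i c : bnd c -> bnd (reflection alpha i c).
  (* s_i carries the string lam + k s_i(c) to the string s_i(lam) + k c. *)
  move=> cb lam; have [N NP] := cb (reflection alpha i lam); exists N => k /(hw_weight_reflection i) wk.
  apply: NP; move: wk; rewrite addrC -scaler_nat reflectionP reflectionK addrC.
  by rewrite scaler_nat.
have fold w c : bnd c -> bnd (foldr (reflection alpha) c w).
  by move=> cb; elim: w => //= i w; exact: refl.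
have simp i : bnd (alpha_ i).
  move=> lam; have [ht [htD htw]] := height_exists real_alpha.
  have htk k : ht (alpha_ i *+ k) = k%:R by rewrite -wsum_nseq htw size_nseq.
  (* Each alpha_i raises the height by 1, and no weight is higher than Lam. The absolute value is
     harmless: if some k qualifies, the difference is nonnegative. *)
  exists `|Num.ceil (ht Lam - ht lam)|%N => k [u /hw_weight h] /h[w] /(inF_inj charF) e.
  have {}e : lam + alpha_ i *+ k + wsum w = Lam by rewrite e subrK.
  have ek : k%:R + (size w)%:R = ht Lam - ht lam :> rat.
    by rewrite -e !htD htk htw; ring.
  have kle : k%:R <= ht Lam - ht lam by rewrite -ek lerDl ler0n.
  have : (k%:Z <= Num.ceil (ht Lam - ht lam))%R.
    by rewrite -(ler_int rat); apply: (le_trans kle); exact: ceil_ge.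
  lia.
have real c : real_roots alpha c -> bnd c by move=> [w [i ->]]; apply: fold; exact: simp.
have realN c : real_roots alpha c -> real_roots alpha (- c).
  (* s_i alpha_i = -alpha_i, so one more reflection at the inner end of the word changes the
     sign. *)
  move=> [w [i ->]]; exists (rcons w i), i; rewrite -cats1 foldr_cat /=.
  have -> : reflection alpha i (alpha_ i) = - alpha_ i.
    by rewrite /reflection real_alpha.2 gcmA.1 scaler_nat mulr2n opprD addrA subrr sub0r.
  elim: w => //= j w <-.
  by rewrite /(reflection _ _ (- _)) pairingNl scaleNr -opprD.
by move=> [/real//|/realN]; rewrite opprK => /real.
Qed.
End HighestWeight.
End Integrability.

(** * Restricted duals as objects of the category *)

Section Projections.
Variables (F : fieldType) (n : nat) (A : 'M[int]_n) (alpha : 'M[int]_(n, dimH A)).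
Variable V : gmod F alpha.
Hypothesis sumV : forall u : V, weight_sum u.

Notation P := 'rV[int]_(dimH A).
Notation fh := 'rV[F]_(dimH A).

Lemma eq_on_weights (W : lmodType F) (f f' : V -> W) : linear f -> linear f' ->
  (forall mu u, weight_space V mu u -> f u = f' u) -> f =1 f'.
Proof.
move=> lf lf' e u; have [s ws ->] := sumV u.
elim: s ws => [|p s IH] ws; first by rewrite big_nil !linear_fun0.
have [wp {}ws] := weighted_cons ws.
by rewrite big_cons -(scale1r p.2) lf lf' (e _ _ wp) IH.
Qed.

(** The decomposition is picked by choice; [wprojE] shows that the component does not depend on
    it. *)
Definition wproj (mu : fh) (u : V) : V :=
  \sum_(p <- s2val (cid2 (sumV u)) | p.1 == mu) p.2.

Lemma wprojE mu s : weighted s -> wproj mu (\sum_(p <- s) p.2) = \sum_(p <- s | p.1 == mu) p.2.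
Proof.
move=> ws; rewrite /wproj; case: cid2 => /= t wt st.
have := @weighted_sum0 _ _ _ _ V (t ++ [seq (p.1, - p.2) | p <- s]) mu.
rewrite !big_cat !big_map /= -st !sumrN subrr => /(_ _ erefl) e.
apply/eqP; rewrite -subr_eq0; apply/eqP/e => p.
rewrite mem_cat => /orP[/wt//|/mapP[q /ws wq ->]] h /=.
by rewrite linearN /= wq scalerN.
Qed.

Lemma weighted1 mu (u : V) : weight_space V mu u -> weighted [:: (mu, u)].
Proof. by move=> umu p; rewrite inE => /eqP ->. Qed.

Lemma wproj_weight mu lam u : weight_space V lam u ->
  wproj mu u = if lam == mu then u else 0.
Proof. by move=> /weighted1/(wprojE mu); rewrite big_seq1 big_mkcond big_seq1. Qed.

Lemma wproj_in mu u : weight_space V mu (wproj mu u).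
Proof.
rewrite /wproj; case: cid2 => /= s ws _ h; rewrite linear_sum scaler_sumr.
rewrite big_seq_cond [RHS]big_seq_cond; apply: eq_bigr => p /andP[ps /eqP <-].
by rewrite /= (ws _ ps).
Qed.

Lemma wproj_linear mu : linear (wproj mu).
Proof.
move=> c u w; have [s ws ->] := sumV u; have [t wt ->] := sumV w.
rewrite !wprojE //; have -> : c *: (\sum_(p <- s) p.2) + \sum_(p <- t) p.2 =
   \sum_(p <- [seq (p.1, c *: p.2) | p <- s] ++ t) p.2.
  by rewrite big_cat big_map scaler_sumr.
rewrite wprojE; first by rewrite big_cat big_map scaler_sumr.
move=> p; rewrite mem_cat => /orP[/mapP[q /ws wq ->] h /=|/wt//].
by rewrite linearZ /= wq !scalerA mulrC.
Qed.

Fact rproj_subproof mu (phi : rdual V) : rdual_pred (fun u : V => phi (wproj mu u) : F^o).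
Proof.
apply/asboolP; split; first by move=> c u w; rewrite wproj_linear linearP.
apply: (sub_finite_set _ (finite_set1 mu)) => lam [u ul].
by rewrite (wproj_weight _ ul); case: (lam =P mu) => //; rewrite linear0 eqxx.
Qed.
Definition rproj mu (phi : rdual V) : rdual V := Rdual (rproj_subproof mu phi).

Lemma rdual_eq_on_weights (phi psi : rdual V) :
  (forall mu u, weight_space V mu u -> phi u = psi u) -> phi = psi.
Proof. by move=> e; apply: rdualP; apply: eq_on_weights e; exact: rdual_linear. Qed.

Lemma weight_rproj mu (phi : rdual V) : weight_space (rdual_gmod V) (- mu) (rproj mu phi).
Proof.
move=> h; apply: rdual_eq_on_weights => lam u ul /=.
rewrite ul; have := wproj_linear mu (pairing lam h) u 0.
rewrite addr0 => ->; rewrite (wproj_weight _ (_ : weight_space V lam 0)); last first.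
  by move=> h'; rewrite linear0 scaler0.
rewrite if_same addr0 (wproj_weight _ ul) fctE /= pairingNl.
rewrite !(wproj_weight _ ul); case: eqP => [->|_]; last by rewrite ?scaler0 ?linear0 ?scaler0 ?oppr0 ?scaler0.
by rewrite linearZ scaleNr.
Qed.

Lemma rdual_weight_eq0 lam mu (phi : rdual V) u : weight_space (rdual_gmod V) lam phi ->
  weight_space V mu u -> phi u != 0 -> lam = - mu.
Proof.
move=> philam umu phiu; apply: pairing_inj => h.
have := congr1 (fun psi : rdual V => psi u) (philam h); rewrite /= umu linearZ /= => /eqP.
rewrite fctE -scaleNr -subr_eq0 -scalerBl scaler_eq0 (negPf phiu) orbF subr_eq0 pairingNl.
by move/eqP.
Qed.

(** Finite support is what makes the restricted dual, unlike the full one, the sum of its weight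
    spaces. *)
Lemma rproj_sum (phi : rdual V) : exists s : seq fh,
  (forall mu, mu \in s -> exists2 u, weight_space V mu u & phi u != 0) /\
  phi = \sum_(mu <- s) rproj mu phi.
Proof.
have /finite_seqP[s0 s0P] := rdual_finite phi.
have s0E mu : (mu \in s0) <-> exists2 u, weight_space V mu u & phi u != 0.
  have -> : (exists2 u, weight_space V mu u & phi u != 0) = [set` s0] mu by rewrite -s0P.
  by [].
exists (undup s0); split; first by move=> mu; rewrite mem_undup => /s0E.
have sumE s u : (\sum_(mu <- s) rproj mu phi : rdual V) u = \sum_(mu <- s) phi (wproj mu u).
  by elim: s => [|mu s IH]; rewrite ?big_nil // !big_cons -IH.
apply: rdual_eq_on_weights => lam u ul; rewrite sumE.
rewrite (eq_bigr (fun mu => if mu == lam then phi u else 0)); last first.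
  by move=> mu _; rewrite (wproj_weight _ ul) eq_sym; case: eqP => //; rewrite linear0.
rewrite -big_mkcond /=; have [ls|ls] := boolP (lam \in undup s0).
  by rewrite (big_rem lam ls) /= eqxx big_seq_cond big1 ?addr0 // => mu;
    rewrite (mem_rem_uniq _ (undup_uniq _)) inE => /andP[/andP[/negPf->]].
have -> : phi u = 0.
  by apply/eqP; apply: contraNT ls => pu; rewrite mem_undup; apply/s0E; exists u.
by rewrite big1.
Qed.
End Projections.

(** * The restricted dual of an irreducible highest weight module *)

Section DualObject.
Variables (F : fieldType) (n : nat) (A : 'M[int]_n) (alpha : 'M[int]_(n, dimH A)).
Hypothesis charF : [pchar F] =i pred0.
Hypothesis gcmA : gcm A.
Hypothesis real_alpha : realization alpha.

Notation P := 'rV[int]_(dimH A).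
Notation fh := 'rV[F]_(dimH A).
Notation inF := (inF F).
Notation wsum := (wsum alpha).
Notation gmod := (gmod F alpha).

Lemma root_space_weight (V : gmod) b (x : km F alpha) (lam : fh) (u : V) : root_space b x ->
  weight_space V lam u -> weight_space V (lam + inF b) (gact x u).
Proof.
move=> xb ul h; rewrite gact_swap xb gactZl ul linearZ /= -scalerDl pairingDl.
by rewrite addrC.
Qed.

Lemma root_space_weight_iter (V : gmod) b (x : km F alpha) (lam : P) (u : V) k : root_space b x ->
  weight_space V (inF lam) u -> weight_space V (inF (lam + b *+ k)) (iter k (gact x) u).
Proof.
move=> xb ul; elim: k => [|k IH]; first by rewrite mulr0n addr0.
by rewrite mulrSr addrA inFD; exact: root_space_weight.
Qed.

Variables (V : gmod) (Lam : Pplus A) (v : V).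
Hypothesis hwV : irreducible_hw Lam v.

Let sumV := irreducible_weight_sum hwV.

Lemma rdual_neq0 (phi : rdual V) : phi != 0 ->
  exists w u, weight_space V (inF ((Lam : P) - wsum w)) u /\ phi u != 0.
Proof.
move=> phi0; apply: contrapT => no; move/eqP: phi0; apply.
apply: (rdual_eq_on_weights sumV) => mu u umu; apply/eqP; apply: contrapT => /negP pu.
have u0 : u != 0 by apply: contraNneq pu => ->; rewrite linear0.
by have [w muw] := hw_weight hwV umu u0; apply: no; exists w, u; rewrite -muw.
Qed.

Lemma rdual_is_weight lam (phi : rdual V) : weight_space (rdual_gmod V) lam phi -> phi != 0 ->
  exists w, lam = inF (wsum w - (Lam : P)) /\ is_weight V ((Lam : P) - wsum w).
Proof.
move=> phil /rdual_neq0[w [u [uw pu]]]; exists w; split.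
  by rewrite (rdual_weight_eq0 phil uw pu) -inFN opprB.
by exists u => //; apply: contraNneq pu => ->; rewrite linear0.
Qed.

Lemma rdual_diag (phi : rdual V) : exists2 s : seq (P * rdual_gmod V),
    (forall p, p \in s -> weight_space (rdual_gmod V) (inF p.1) p.2) & phi = \sum_(p <- s) p.2.
Proof.
have [s [sP phiE]] := rproj_sum sumV phi.
have /boolp.choice[lamf lamP] (mu : fh) : exists lam : P, mu \in s -> inF lam = - mu.
  have [ms|] := boolP (mu \in s); last by exists 0.
  have [u um pu] := sP _ ms.
  have u0 : u != 0 by apply: contraNneq pu => ->; rewrite linear0.
  by have [w ->] := hw_weight hwV um u0; exists (- ((Lam : P) - wsum w)) => _; rewrite inFN.
exists [seq (lamf mu, rproj sumV mu phi : rdual_gmod V) | mu <- s]; last by rewrite big_map.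
by move=> _ /mapP[mu ms ->] /=; rewrite lamP //; exact: weight_rproj.
Qed.

(** x^k shifts a weight by k b, and weights of the dual are negatives of weights of [V], so a finite
    string of [V] in direction -b suffices. *)
Lemma rdual_nilp b (x : km F alpha) : real_roots alpha b -> root_space b x ->
  forall phi : rdual_gmod V, exists k, iter k (gact x) phi = 0.
Proof.
move=> rb xb phi; have [s sP ->] := rdual_diag phi.
elim: s sP => [|p s IH] sP; first by exists 0%N; rewrite big_nil.
have [|k kP] := IH; first by move=> q qs; apply: sP; rewrite inE qs orbT.
have rb' : real_roots alpha (- b) \/ real_roots alpha (- - b) by right; rewrite opprK.
have [N NP] := hw_real_string charF gcmA real_alpha hwV rb' (- p.1).
have pN : iter N.+1 (gact x) p.2 = 0.
  apply: contrapT => /eqP nz.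
  have wp : weight_space (rdual_gmod V) (inF p.1) p.2 by apply: sP; rewrite mem_head.
  have [w [/(inF_inj charF) e wV]] := rdual_is_weight (root_space_weight_iter N.+1 xb wp) nz.
  suff : (N.+1 <= N)%N by rewrite ltnn.
  by apply: NP; rewrite mulNrn -opprD e opprB.
exists (N.+1 + k)%N; rewrite big_cons (linear_funD (iter_linear _ (gact_linear x))).
rewrite (iter_linear_leq0 (gact_linear x) _ pN) ?leq_addr // (iter_linear_leq0 (gact_linear x) _ kP) ?leq_addl //.
exact: addr0.
Qed.

(** A form of weight lam sees only the weight space -lam of [V]. That space is spanned by words of
    one fixed length, since the height counts letters, so finitely many evaluations separate such
    forms. *)
Lemma rdual_fin_dim (lam : P) : exists s : seq (rdual_gmod V), forall phi,
  weight_space (rdual_gmod V) (inF lam) phi ->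
  exists c : nat -> F, phi = \sum_(k < size s) c k *: s`_k.
Proof.
have [N NP] : exists N, forall w, (Lam : P) - wsum w = - lam -> size w = N.
  have [[w0 w0P]|no] := pselect (exists w, (Lam : P) - wsum w = - lam); last first.
    by exists 0%N => w wP; exfalso; apply: no; exists w.
  exists (size w0) => w wP; apply: (wsum_size real_alpha).
  by apply: oppr_inj; apply: (addrI (Lam : P)); rewrite wP w0P.
pose ls : seq (rdual_gmod V -> F^o) :=
  [seq (fun phi : rdual_gmod V => (phi : rdual V) (fword (w : seq 'I_n) v)) | w : N.-tuple 'I_n <- enum {: N.-tuple 'I_n}].
apply: (@separating_finite_span _ _ ls (weight_space (rdual_gmod V) (inF lam))).
- by move=> l /mapP[w _ ->] c phi psi.
- by move=> c phi psi phil psil h; rewrite gact_linear phil psil scalerDr !scalerA mulrC.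
move=> phi phil phi0; apply: (rdual_eq_on_weights sumV) => mu u umu.
apply/eqP; apply: contrapT => /negP pu.
have muE : inF lam = - mu := rdual_weight_eq0 phil umu pu.
have vL : weight_space V (inF Lam) v by case: hwV.
have [s [sP us]] := fspan_weight vL (hw_fspan hwV u) umu.
move/negP: pu; rewrite us linear_sum big_seq big1 ?eqxx // => p ps.
have sz : size p.2 == N.
  apply/eqP/NP/(inF_inj charF); rewrite sP // inFN.
  by rewrite muE opprK.
rewrite linearZ /=; have /phi0 : (fun phi : rdual_gmod V => (phi : rdual V) (fword p.2 v)) \in ls.
  by apply/mapP; exists (Tuple sz); rewrite ?mem_enum.
by move=> ->; rewrite scaler0.
Qed.

Lemma rdual_Oint : Oint (rdual_gmod V).
Proof.
split; [split; [exact: rdual_diag|exact: rdual_nilp]|exact: rdual_fin_dim|].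
exists [:: - inF Lam] => lam [phi phil phi0].
have [w [-> _]] := rdual_is_weight phil phi0.
exists (- inF Lam); first by rewrite mem_head.
by exists (wsum w); [apply/Qplus_wsum; exists w|rewrite inFB addrC].
Qed.
End DualObject.

(** * Exponentials of derivations *)

Section Exponential.
Variable F : fieldType.
Hypothesis charF : [pchar F] =i pred0.

Lemma exp_act_nilp (V : lmodType F) (f : V -> V) N u : linear f -> iter N f u = 0 ->
  exp_act f u = \sum_(k < N) (k`!%:R : F)^-1 *: iter k f u.
Proof.
move=> lf fN; rewrite /exp_act (fsbigE (iota 0 N)) ?iota_uniq //; last first.
  by move=> k _; rewrite mem_iota add0n /= -leqNgt => Nk; rewrite (iter_linear_leq0 lf Nk fN) scaler0.
rewrite -[iota 0 N](_ : index_iota 0 N = _); last by rewrite /index_iota subn0.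
by rewrite big_mkord; apply: eq_bigl => k; rewrite in_setT.
Qed.

Section Leibniz.
Variables (V W U : lmodType F) (B : V -> W -> U) (dV : V -> V) (dW : W -> W) (dU : U -> U).
Hypotheses (Bl : forall w, linear (B^~ w)) (Br : forall v, linear (B v)).
Hypotheses (lV : linear dV) (lW : linear dW) (lU : linear dU).
Hypothesis dB : forall v w, dU (B v w) = B (dV v) w + B v (dW w).

Lemma leibniz_iter k v w : iter k dU (B v w) =
  \sum_(i < k.+1) B (iter i dV v) (iter (k - i) dW w) *+ 'C(k, i).
Proof.
elim: k => [|k IH]; first by rewrite big_ord1 bin0 mulr1n.
have dUB i j m : dU (B (iter i dV v) (iter j dW w) *+ m) =
    B (iter i.+1 dV v) (iter j dW w) *+ m + B (iter i dV v) (iter j.+1 dW w) *+ m.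
  by rewrite -scaler_nat linear_funZ // dB scalerDr !scaler_nat.
rewrite iterS IH linear_fun_sum // (eq_bigr _ (fun (i : 'I_k.+1) _ => dUB i _ _)) big_split /=.
rewrite [X in X + _]big_ord_recr /= [X in _ + X]big_ord_recl /=.
rewrite [RHS]big_ord_recl big_ord_recr /= !bin0 !binn subnn !subn0.
rewrite [LHS]addrCA [X in _ + X]addrAC; congr (_ + (_ + _)); last by rewrite /bump add1n subnn add0n.
rewrite -big_split /=; apply: eq_bigr => i _.
rewrite /bump !add1n subSS binS mulrnDr addrC; congr (_ *+ _ + _).
by rewrite -(subnSK (ltn_ord i)).
Qed.

Lemma iter_bilinear_nilp N M v w : iter N dV v = 0 -> iter M dW w = 0 ->
  iter (N + M) dU (B v w) = 0.
Proof.
move=> vN wM; rewrite leibniz_iter big1 // => i _.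
have [Ni|iN] := leqP N i; first by rewrite (iter_linear_leq0 lV Ni vN) (linear_fun0 (Bl _)) mul0rn.
rewrite (@iter_linear_leq0 _ _ dW M) ?(linear_fun0 (Br _)) ?mul0rn //; lia.
Qed.

Lemma factr_neq0 k : (k`!%:R : F) != 0.
Proof. by rewrite natr_eq0_char0 // -lt0n fact_gt0. Qed.

(** Divided powers absorb the binomial coefficients and leave a plain convolution; characteristic 0
    makes the factorials invertible. *)
Lemma leibniz_divided k v w : (k`!%:R : F)^-1 *: iter k dU (B v w) =
  \sum_(i < k.+1) B ((i`!%:R : F)^-1 *: iter i dV v) (((k - i)`!%:R : F)^-1 *: iter (k - i) dW w).
Proof.
rewrite leibniz_iter scaler_sumr; apply: eq_bigr => i _.
rewrite (linear_funZ _ _ (Bl _)) (linear_funZ _ _ (Br _)) scalerA -scaler_nat scalerA.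
congr (_ *: _).
have ik : (i <= k)%N by rewrite -ltnS.
rewrite -(bin_fact ik) !natrM; field.
by rewrite !factr_neq0 natr_eq0_char0 // -lt0n bin_gt0 ik.
Qed.

Lemma exp_bilinear v w : (exists N, iter N dV v = 0) -> (exists N, iter N dW w = 0) ->
  exp_act dU (B v w) = B (exp_act dV v) (exp_act dW w).
Proof.
move=> [N vN] [M wM].
rewrite (exp_act_nilp lU (iter_bilinear_nilp vN wM)) (exp_act_nilp lV vN) (exp_act_nilp lW wM).
pose a i := (i`!%:R : F)^-1 *: iter i dV v; pose b j := (j`!%:R : F)^-1 *: iter j dW w.
have a0 i : (N <= i)%N -> a i = 0 by move=> Ni; rewrite /a (iter_linear_leq0 lV Ni vN) scaler0.
have b0 j : (M <= j)%N -> b j = 0 by move=> Mj; rewrite /b (iter_linear_leq0 lW Mj wM) scaler0.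
(* Cauchy product: i < N and j < M imply i + j < N + M, so the triangle i <= k < N + M contains the
   whole rectangle, and outside the rectangle [a] or [b] vanishes. *)
transitivity (\sum_(i < N) \sum_(j < M) B (a i) (b j)); last first.
  rewrite (linear_fun_sum _ _ _ (Bl _)); apply: eq_bigr => i _.
  by rewrite (linear_fun_sum _ _ _ (Br _)).
transitivity (\sum_(0 <= k < N + M) \sum_(0 <= i < N + M | (i <= k)%N) B (a i) (b (k - i)%N)).
  rewrite big_mkord; apply: eq_bigr => k _; rewrite leibniz_divided.
  rewrite -(big_mkord xpredT (fun i => B (a i) (b (k - i)%N))).
  by rewrite (big_nat_widen _ _ (N + M)%N).
rewrite (exchange_big_dep_nat xpredT) //=.
rewrite (@big_cat_nat _ _ _ N) ?leq_addr //= [X in _ + X]big_nat [X in _ + X]big1 ?addr0; last first.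
  move=> i /andP[Ni _]; apply: big1 => k _; rewrite a0 //; exact: linear_fun0 (Bl _).
rewrite big_mkord; apply: eq_bigr => i _.
transitivity (\sum_(i <= k < N + M) B (a i) (b (k - i)%N)).
  by rewrite [RHS](big_nat_widenl _ 0).
rewrite -[X in \sum_(X <= _ < _) _]add0n big_addn.
have MNi : (M <= N + M - i)%N by have := ltn_ord i; lia.
rewrite (@big_cat_nat _ _ _ M) //= [X in _ + X]big_nat [X in _ + X]big1 ?addr0; last first.
  by move=> j /andP[Mj _]; rewrite addnK b0 // (linear_fun0 (Br _)).
by rewrite big_mkord; apply: eq_bigr => j _; rewrite addnK.
Qed.
End Leibniz.
End Exponential.

(** * The formal group acts by group-like elements *)

Section Grouplike.
Variables (F : fieldType) (n : nat) (A : 'M[int]_n) (alpha : 'M[int]_(n, dimH A)).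
Hypothesis charF : [pchar F] =i pred0.
Hypothesis real_alpha : realization alpha.

Notation P := 'rV[int]_(dimH A).
Notation fh := 'rV[F]_(dimH A).
Notation inF := (inF F).
Notation wsum := (wsum alpha).
Notation gmod := (gmod F alpha).
Notation ointmod := (ointmod F alpha).

Lemma Oint_eq (V : ointmod) (W : lmodType F) (f f' : V -> W) : linear f -> linear f' ->
  (forall (lam : P) u, weight_space V (inF lam) u -> f u = f' u) -> f =1 f'.
Proof.
move=> lf lf' e u; have [s ws ->] := integrable_diag (Oint_integrable (omodP V)) u.
rewrite !linear_fun_sum // big_seq [RHS]big_seq; apply: eq_bigr => p ps.
exact/e/ws.
Qed.

Lemma Oint_closed (V : ointmod) (S : V -> Prop) : S 0 ->
  (forall u w, S u -> S w -> S (u + w)) ->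
  (forall (lam : P) u, weight_space V (inF lam) u -> S u) -> forall u, S u.
Proof.
move=> S0 SD Sw u; have [s ws ->] := integrable_diag (Oint_integrable (omodP V)) u.
rewrite big_seq; elim/big_ind: _ => // p ps; exact/Sw/ws.
Qed.

(* Weights of an object lie in finitely many cones mu + Q+, so only boundedly many
   simple roots can be subtracted from a given weight. *)
Lemma depth_bound (V : ointmod) (lam : P) :
  exists N, forall w, is_weight V (lam - wsum w) -> (size w <= N)%N.
Proof.
have [s sP] := Oint_bounded (omodP V).
(* An arbitrary set of words is needed for the induction on the apexes: those covered by the
   remaining apexes are bounded separately. *)
suff gen (W : seq 'I_n -> Prop) : (forall w, W w ->
    exists2 mu, mu \in s & exists q, inF (lam - wsum w) = mu + inF (wsum q)) ->
    exists N, forall w, W w -> (size w <= N)%N.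
  apply: gen => w /sP[mu ms [_ /Qplus_wsum[q ->] e]]; exists mu => //; by exists q.
elim: s W {sP} => [|mu s IH] W WP; first by exists 0%N => w /WP[].
have [N NP] := IH (fun w => W w /\ exists2 mu', mu' \in s &
    exists q, inF (lam - wsum w) = mu' + inF (wsum q)) (fun w => @proj2 _ _).
have [[w0 [q0 e0]]|no] :=
    pselect (exists w0 q0, inF (lam - wsum w0) = mu + inF (wsum q0)).
  exists (maxn N (size w0 + size q0)) => w Ww; rewrite leq_max.
  have [mu'] := WP w Ww; rewrite inE => /orP[/eqP ->|ms] [q e]; last first.
    by rewrite NP //; split => //; exists mu' => //; exists q.
  (* For a fixed apex mu, wsum w + wsum q = lam - mu, so the total number of letters is constant. *)
  apply/orP; right; suff -> : (size w0 + size q0 = size w + size q)%N by exact: leq_addr.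
  rewrite -!size_cat; apply: (wsum_size real_alpha); rewrite !wsum_cat.
  apply: (inF_inj charF); rewrite !inFD; apply: (addrI mu).
  by rewrite addrCA -e0 [RHS]addrCA -e !inFB !subrKC.
exists N => w Ww; have [mu'] := WP w Ww; rewrite inE => /orP[/eqP ->|ms] [q e].
  by exfalso; apply: no; exists w, q.
by apply: NP; split => //; exists mu' => //; exists q.
Qed.

Lemma negative_root_wsum b : negative_roots F alpha b -> exists2 w, w != [::] & b = - wsum w.
Proof.
move=> [[b0 _] /Qplus_wsum[w bw]]; exists w; last by rewrite -bw opprK.
by apply: contraNneq b0 => w0; rewrite -oppr_eq0 bw w0 wsum_nil.
Qed.

Section NilradicalAction.
Variable x : P -> km F alpha.
Hypothesis xP : forall b, negative_roots F alpha b -> root_space b (x b).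

(** On a vector of weight lam, a root -wsum w leads to weight lam - wsum w, and [depth_bound] leaves
    finitely many w. Without this the finitely supported sum [nf_act] could fall back to its default
    value 0. *)
Lemma nf_support (V : ointmod) (u : V) : exists s : seq P,
  forall b, negative_roots F alpha b -> b \notin s -> gact (x b) u = 0.
Proof.
elim/Oint_closed: u => [|u w [s sP] [t tP]|lam u ul].
- by exists [::] => b _ _; rewrite linear0.
- exists (s ++ t) => b nb; rewrite mem_cat negb_or => /andP[bs bt].
  by rewrite linearD /= sP // tP // addr0.
have [N NP] := depth_bound V lam.
exists (flatten [seq [seq - wsum (tval w) | w <- enum {: k.-tuple 'I_n}] | k <- iota 0 N.+1]).
move=> b nb bs; apply: contrapT => /eqP nz; move/negP: bs; apply.
have [w _ bw] := negative_root_wsum nb.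
have wl : (size w <= N)%N.
  apply: NP; exists (gact (x b) u) => //; rewrite -bw inFD.
  exact: root_space_weight (xP nb) ul.
apply/flattenP; exists [seq - wsum (tval w0) | w0 <- enum {: (size w).-tuple 'I_n}].
  by apply/mapP; exists (size w); rewrite // mem_iota add0n ltnS.
by apply/mapP; exists (in_tuple w); rewrite ?mem_enum.
Qed.

Definition neg_seq (s : seq P) : seq P := undup [seq b <- s | `[< negative_roots F alpha b >]].

Lemma nf_actE (V : ointmod) (u : V) s :
  (forall b, negative_roots F alpha b -> b \notin s -> gact (x b) u = 0) ->
  nf_act x u = \sum_(b <- neg_seq s) gact (x b) u.
Proof.
move=> sP; rewrite /nf_act (fsbigE (neg_seq s)) ?undup_uniq //.
- rewrite big_seq_cond [RHS]big_seq; apply: eq_bigl => b; case: (boolP (b \in neg_seq s)) => //=.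
  by rewrite mem_undup mem_filter => /andP[/asboolP nb _]; rewrite mem_set.
- by move=> b /=; rewrite mem_undup mem_filter => /andP[/asboolP].
- move=> b nb; rewrite mem_undup mem_filter negb_and => /orP[/asboolP//|bs].
  exact: sP.
Qed.

Lemma nf_act_linear (V : ointmod) : linear (@nf_act _ _ _ _ V x).
Proof.
move=> c u w; have [s sP] := nf_support u; have [t tP] := nf_support w.
have notin (b : P) : b \notin s ++ t -> b \notin s /\ b \notin t.
  by rewrite mem_cat negb_or => /andP.
rewrite (@nf_actE V u (s ++ t)) => [|b nb /notin[bs _]]; last exact: sP.
rewrite (@nf_actE V w (s ++ t)) => [|b nb /notin[_ bt]]; last exact: tP.
rewrite (@nf_actE V (c *: u + w) (s ++ t)) => [|b nb /notin[bs bt]]; last first.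
  by rewrite linearP /= sP // tP // scaler0 addr0.
by rewrite scaler_sumr -big_split; apply: eq_bigr => b _; rewrite linearP.
Qed.

Lemma nf_act_deriv (V W U : ointmod) (B : V -> W -> U) :
  (forall w, linear (B^~ w)) -> (forall v, linear (B v)) ->
  (forall y v w, gact y (B v w) = B (gact y v) w + B v (gact y w)) ->
  forall v w, nf_act x (B v w) = B (nf_act x v) w + B v (nf_act x w).
Proof.
move=> Bl Br Bx v w; have [s sP] := nf_support v; have [t tP] := nf_support w.
have notin (b : P) : b \notin s ++ t -> b \notin s /\ b \notin t.
  by rewrite mem_cat negb_or => /andP.
rewrite (@nf_actE V v (s ++ t)) => [|b nb /notin[bs _]]; last exact: sP.
rewrite (@nf_actE W w (s ++ t)) => [|b nb /notin[_ bt]]; last exact: tP.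
rewrite (@nf_actE U (B v w) (s ++ t)) => [|b nb /notin[bs bt]]; last first.
  by rewrite Bx sP // tP // (linear_fun0 (Bl _)) (linear_fun0 (Br _)) addr0.
rewrite (linear_fun_sum _ _ _ (Bl _)) (linear_fun_sum _ _ _ (Br _)) -big_split.
by apply: eq_bigr => b _; rewrite Bx.
Qed.

Lemma nf_act_nilp (V : ointmod) (u : V) : exists N, iter N (nf_act x) u = 0.
Proof.
have lx := @nf_act_linear V.
elim/Oint_closed: u => [|u w [k ku] [m mw]|lam u ul]; first by exists 0%N.
  exists (k + m)%N; rewrite (linear_funD (iter_linear _ lx)).
  rewrite (iter_linear_leq0 lx _ ku) ?leq_addr // (iter_linear_leq0 lx _ mw) ?leq_addl //.
  by rewrite addr0.
have [N NP] := depth_bound V lam.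
(* [D m] collects sums of weight vectors at depth at least m below lam. Every negative root has
   depth at least 1, so [nf_act] maps [D m] into [D m.+1], and depth N+1 contains only 0. *)
pose D m : set V := [set u | exists2 s : seq (seq 'I_n * V),
  (forall p, p \in s -> (m <= size p.1)%N /\ weight_space V (inF (lam - wsum p.1)) p.2) &
  u = \sum_(p <- s) p.2].
have DD m y z : D m y -> D m z -> D m (y + z).
  move=> [s sP ->] [t tP ->]; exists (s ++ t); last by rewrite big_cat.
  by move=> p; rewrite mem_cat => /orP[/sP|/tP].
have D0 m : D m 0 by exists [::]; rewrite ?big_nil.
have Dx m y : D m y -> D m.+1 (nf_act x y).
  move=> [s sP ->]; rewrite linear_fun_sum // big_seq.
  elim/big_ind: _ => // [y1 y2|p ps]; first exact: DD.
  have [t tP] := nf_support p.2; rewrite (nf_actE tP) big_seq.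
  elim/big_ind: _ => // [y1 y2|b]; first exact: DD.
  rewrite mem_undup mem_filter => /andP[/asboolP nb _].
  have [mp wp] := sP _ ps; have [w w0 bw] := negative_root_wsum nb.
  exists [:: (p.1 ++ w, gact (x b) p.2)]; last by rewrite big_seq1.
  move=> _ /[!inE]/eqP -> /=; split.
    rewrite size_cat; case: w w0 {bw} => // i w _; rewrite /= addnS ltnS.
    by rewrite (leq_trans mp) ?leq_addr.
  rewrite wsum_cat opprD addrA -bw inFD.
  exact: root_space_weight (xP nb) wp.
exists N.+1.
have : D N.+1 (iter N.+1 (nf_act x) u).
  elim: N.+1 => [|m IH]; last exact: Dx.
  exists [:: ([::], u)]; last by rewrite big_seq1.
  by move=> p /[!inE]/eqP -> /=; split => //; rewrite wsum_nil subr0.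
move=> [s sP ->]; rewrite big_seq big1 // => p /sP[lp wp].
apply: contrapT => /eqP p0; suff : (N.+1 <= N)%N by rewrite ltnn.
by apply: (leq_trans lp); apply: NP; exists p.2.
Qed.
End NilradicalAction.

(** This replaces the usual condition that eta acts on V (x) W as eta (x) eta: all equivariant
    bilinear maps into an object are tested instead. *)
Definition grouplike (eta : natend F alpha) := forall (V W U : ointmod) (B : V -> W -> U),
  (forall w, linear (B^~ w)) -> (forall v, linear (B v)) ->
  (forall y v w, gact y (B v w) = B (gact y v) w + B v (gact y w)) ->
  forall v w, eta U (B v w) = B (eta V v) (eta W w).

Lemma Gfn_grouplike eta : Gfn_gen eta -> grouplike eta.
Proof.
elim=> {eta} [h s eta s0 etaE|x eta xP etaE|b x eta rb _ xb etaE|eta etaE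
  |eta1 eta2 eta _ IH1 _ IH2 etaE|eta eta' _ IH K K'] V W U B Bl Br Bx v w.
- move: v; apply: Oint_eq => [c u u'|c u u'|lam v vl].
  + by rewrite Bl nat_linear.
  + by rewrite nat_linear Bl.
  move: w; apply: Oint_eq => [c u u'|c u u'|mu w wm].
  + by rewrite Br nat_linear.
  + by rewrite nat_linear Br.
  rewrite (etaE _ _ _ vl) (etaE _ _ _ wm) (linear_funZ _ _ (Bl _)) (linear_funZ _ _ (Br _)).
  rewrite (etaE _ (lam + mu)) ?scalerA ?pairingDl ?expfzDr // => h'.
  by rewrite Bx vl wm inFD pairingDl (linear_funZ _ _ (Bl _)) (linear_funZ _ _ (Br _)) scalerDl.
- rewrite !etaE; apply: (exp_bilinear charF Bl Br).
  + exact: nf_act_linear.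
  + exact: nf_act_linear.
  + exact: nf_act_linear.
  + exact: nf_act_deriv.
  + exact: nf_act_nilp.
  + exact: nf_act_nilp.
- have nilp (V' : ointmod) u := integrable_nilp (Oint_integrable (omodP V')) rb xb u.
  rewrite !etaE; apply: (exp_bilinear charF Bl Br) => //; exact: gact_linear.
- by rewrite !etaE.
- by rewrite !etaE IH2 // IH1.
(* Injectivity of [eta] reduces the claim for the inverse to the one for [eta]. *)
- by apply: (can_inj (K U)); rewrite K' IH // !K'.
Qed.
End Grouplike.

(** * The Cartan product of nonzero forms is nonzero *)

Section LowerNilpotency.
Variables (F : fieldType) (n : nat) (A : 'M[int]_n) (alpha : 'M[int]_(n, dimH A)).
Hypothesis charF : [pchar F] =i pred0.
Hypothesis real_alpha : realization alpha.

Notation P := 'rV[int]_(dimH A).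
Notation f_ := (km_f F alpha).

(** Every word of length k in the f_i kills u. All f_i are counted together, so that k can serve as
    the decreasing measure in [hprod_neq0]. *)
Fixpoint lnil (k : nat) (V : gmod F alpha) (u : V) : Prop :=
  if k is k'.+1 then forall i, lnil k' (gact (f_ i) u) else u = 0.

Lemma lnilS k (V : gmod F alpha) (u : V) : lnil k u -> lnil k.+1 u.
Proof.
elim: k u => [|k IH] u; first by move=> -> i; rewrite linear0.
by move=> ku i; apply: IH; exact: ku.
Qed.

Lemma lnil_leq k m (V : gmod F alpha) (u : V) : (k <= m)%N -> lnil k u -> lnil m u.
Proof. by move=> /subnK <-; elim: (m - k)%N => //= j IH /IH /lnilS. Qed.

Lemma lnilD k (V : gmod F alpha) (u w : V) : lnil k u -> lnil k w -> lnil k (u + w).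
Proof.
elim: k u w => [|k IH] u w; first by move=> -> ->; rewrite /= addr0.
by move=> ku kw i; rewrite linearD; apply: IH; [exact: ku|exact: kw].
Qed.

Lemma lnil_iter k m (V : gmod F alpha) (u : V) i :
  lnil k u -> lnil (k - m) (iter m (gact (f_ i)) u).
Proof.
elim: m k u => [|m IH] [|k] u ku //=; last by rewrite -iterS iterSr subSS; apply: IH; exact: ku.
by rewrite ku (iter_linear0 _ (gact_linear _)) linear0.
Qed.

Lemma lnil_iter0 k (V : gmod F alpha) (u : V) i : lnil k u -> iter k (gact (f_ i)) u = 0.
Proof. by move=> /(lnil_iter k i); rewrite subnn. Qed.

Lemma Oint_lnil (V : ointmod F alpha) (u : V) : exists k, lnil k u.
Proof.
elim/Oint_closed: u => [|u w [k ku] [m mw]|lam u ul]; first by exists 0%N.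
  exists (k + m)%N; apply: lnilD; first by apply: lnil_leq ku; rewrite leq_addr.
  by apply: lnil_leq mw; rewrite leq_addl.
have [N NP] := depth_bound charF real_alpha V lam.
suff gen m w (y : V) : weight_space V (inF F (lam - wsum alpha w)) y ->
    (N < size w + m)%N -> lnil m y.
  by exists N.+1; apply: (gen _ [::]); rewrite ?wsum_nil ?subr0.
elim: m w y => [|m IH] w y yw.
  rewrite addn0 => Nw; apply: contrapT => /eqP y0; suff : (N < N)%N by rewrite ltnn.
  by apply: (leq_trans Nw); apply: NP; exists y.
move=> Nw i; apply: (IH (i :: w)); last by rewrite /= addSnnS.
by rewrite wsum_cons (addrC (simple_root _ _)) opprD addrA inFB; exact: weight_f.
Qed.
End LowerNilpotency.

(** * Tensors as bilinear functions of two forms *)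

Section TensorForms.
Variables (F : fieldType) (n : nat) (A : 'M[int]_n) (alpha : 'M[int]_(n, dimH A)).
Variables V W : gmod F alpha.

Lemma tens0 phi psi : (0 : tens V W) phi psi = 0. Proof. by []. Qed.

Lemma tens_linear_l (t : tens V W) c (phi phi1 phi2 : fdual V) psi :
  (forall v, phi v = c *: phi1 v + phi2 v) -> t phi psi = c *: t phi1 psi + t phi2 psi.
Proof.
move=> e; elim/tens_ind: t => [|v w t IH].
  by rewrite !tens0 scaler0 addr0.
rewrite !tensD IH /= /pure e mulrDl scalerDr.
by rewrite -[(c *: _) * _]mulrA -[c *: (_ * _)]/(c * _) addrACA.
Qed.

Lemma tens_linear_r (t : tens V W) c phi (psi psi1 psi2 : fdual W) :
  (forall v, psi v = c *: psi1 v + psi2 v) -> t phi psi = c *: t phi psi1 + t phi psi2.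
Proof.
move=> e; elim/tens_ind: t => [|v w t IH].
  by rewrite !tens0 scaler0 addr0.
rewrite !tensD IH /= /pure e mulrDr scalerDr.
by rewrite mulrCA -[c *: (_ * _)]/(c * _) addrACA.
Qed.

Lemma tens_opp_l (t : tens V W) (phi phi' : fdual V) psi :
  (forall v, phi v = - phi' v) -> t phi psi = - t phi' psi.
Proof.
move=> e; elim/tens_ind: t => [|v w t IH]; first by rewrite !tens0 oppr0.
by rewrite !tensD IH /= /pure e mulNr opprD.
Qed.

Lemma tens_opp_r (t : tens V W) phi (psi psi' : fdual W) :
  (forall v, psi v = - psi' v) -> t phi psi = - t phi psi'.
Proof.
move=> e; elim/tens_ind: t => [|v w t IH]; first by rewrite !tens0 oppr0.
by rewrite !tensD IH /= /pure e mulrN opprD.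
Qed.
End TensorForms.

(** * Equivariance and nonvanishing of the Cartan product *)

Section CartanProduct.
Variables (F : fieldType) (n : nat) (A : 'M[int]_n) (alpha : 'M[int]_(n, dimH A)).
Variable D : cartan_datum F alpha.
Notation L := (L D).

Lemma hprod_linear_l Lam N (psi : rdual (L N)) :
  linear (fun phi : rdual (L Lam) => hprod phi psi).
Proof.
move=> c phi phi'; apply: rdualP => u.
by rewrite /= /hprod_fun (@tens_linear_l _ _ _ _ _ _ _ c _ (rdual_dual phi) (rdual_dual phi')).
Qed.

Lemma hprod_linear_r Lam N (phi : rdual (L Lam)) :
  linear (fun psi : rdual (L N) => hprod phi psi).
Proof.
move=> c psi psi'; apply: rdualP => u.
by rewrite /= /hprod_fun (@tens_linear_r _ _ _ _ _ _ _ c _ _ (rdual_dual psi) (rdual_dual psi')).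
Qed.

Lemma hprod_equivariant Lam N x (phi : rdual_gmod (L Lam)) (psi : rdual_gmod (L N)) :
  gact x (hprod phi psi : rdual_gmod (L (Lam + N))) =
  hprod (gact x phi : rdual_gmod (L Lam)) psi + hprod phi (gact x psi : rdual_gmod (L N)).
Proof.
apply: rdualP => u; rewrite /= /hprod_fun Phi_equivariant /= /tens_act_fun opprD.
by congr (_ + _); apply/esym; [apply: tens_opp_l|apply: tens_opp_r].
Qed.

Lemma hprod_hwv Lam N (phi : rdual (L Lam)) (psi : rdual (L N)) :
  hprod phi psi (hwv D (Lam + N)) = phi (hwv D Lam) * psi (hwv D N).
Proof. by rewrite /= /hprod_fun Phi_hwv. Qed.

Hypothesis charF : [pchar F] =i pred0.
Hypothesis gcmA : gcm A.
Hypothesis real_alpha : realization alpha.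
Notation f_ := (km_f F alpha).

(** A form killed by all f_i vanishes on every nonempty word, so its value at the highest weight
    vector determines it. *)
Lemma rdual_hwv_neq0 Lam (phi : rdual_gmod (L Lam)) : phi != 0 ->
  (forall i, gact (f_ i) phi = 0) -> (phi : rdual (L Lam)) (hwv D Lam) != 0.
Proof.
move=> phi0 fphi; apply: contra_neqN phi0 => /eqP pv; apply: rdualP => u.
have [s ->] := hw_fspan (hwvP D Lam) u; rewrite linear_sum big1 // => -[c w] _ /=.
rewrite linearZ /=; case: w => [|i w] /=; first by rewrite pv scaler0.
have := congr1 (fun psi : rdual (L Lam) => psi (fword w (hwv D Lam))) (fphi i).
by rewrite /= => /eqP; rewrite oppr_eq0 => /eqP ->; rewrite scaler0.
Qed.

Definition Ldual Lam : ointmod F alpha :=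
  OintMod (rdual_Oint charF gcmA real_alpha (hwvP D Lam)).

(* Applying the derivation f_i^(p+q) with p, q maximal leaves a nonzero multiple of
   the product of f_i^p phi and f_i^q psi, which has smaller depth; at the bottom
   both forms are nonzero on highest weight vectors. *)
Lemma hprod_neq0 Lam N (phi : rdual (L Lam)) (psi : rdual (L N)) :
  phi != 0 -> psi != 0 -> hprod phi psi != 0.
Proof.
have [a aphi] := @Oint_lnil _ _ _ _ charF real_alpha (Ldual Lam) phi.
have [b bpsi] := @Oint_lnil _ _ _ _ charF real_alpha (Ldual N) psi.
have [m] := ubnP (a + b)%N; elim: m a b phi psi aphi bpsi => // m IH a b phi psi aphi bpsi lem phi0 psi0.
have maxi (M : Pplus A) (chi : rdual_gmod (L M)) k i : lnil k chi -> chi != 0 ->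
    exists p, [/\ iter p (gact (f_ i)) chi != 0, iter p.+1 (gact (f_ i)) chi = 0 & (p < k)%N].
  move=> kchi chi0.
  have ex : exists k, iter k (gact (f_ i)) chi == 0 by exists k; apply/eqP/lnil_iter0.
  case: (ex_minnP ex) => -[|p] /eqP p0 pmin; first by move: chi0; rewrite /= in p0; rewrite p0 eqxx.
  exists p; split => //; first by apply/negP => /pmin; rewrite ltnn.
  by apply: pmin; apply/eqP/lnil_iter0.
have [[i pos]|no] := pselect (exists i, gact (f_ i) (phi : rdual_gmod (L Lam)) != 0 \/
    gact (f_ i) (psi : rdual_gmod (L N)) != 0); last first.
  apply/eqP => e; have := hprod_hwv phi psi; rewrite e => /esym/eqP.
  rewrite mulf_eq0; apply/negP; rewrite negb_or.
  by rewrite !rdual_hwv_neq0 // => i; apply: contrapT => /eqP nz; apply: no; exists i; [right|left].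
have [p [p0 pS pa]] := maxi _ _ _ i aphi phi0.
have [q [q0 qS qb]] := maxi _ _ _ i bpsi psi0.
(* Some f_i acts nontrivially on a factor, so the sum of the two depths really drops. *)
have pq : (0 < p + q)%N.
  rewrite lt0n; apply/eqP => /eqP; rewrite addn_eq0 => /andP[/eqP pz /eqP qz].
  by case: pos; rewrite ?pz ?qz /= in pS qS *; rewrite ?pS ?qS eqxx.
have lt : (a - p + (b - q) < m)%N by lia.
have := IH _ _ _ _ (lnil_iter p i aphi) (lnil_iter q i bpsi) lt p0 q0.
set chi := hprod _ _ => chi0; apply/eqP => e.
have plt : (p < (p + q).+1)%N by rewrite ltnS leq_addr.
have := leibniz_iter (@gact_linear _ _ _ _ (rdual_gmod (L (Lam + N))) (f_ i))
  (hprod_equivariant (f_ i)) (p + q) phi psi.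
(* Only the Leibniz term j = p survives: j > p kills the left factor, and j < p leaves more than q
   lowerings on the right one. *)
rewrite [hprod phi psi]e (iter_linear0 _ (gact_linear _)) (bigD1 (Ordinal plt)) //=.
rewrite addKn big1 ?addr0 => [/esym/eqP|j jp]; last first.
  have {jp} jp : j != p :> nat by [].
  have [pj|jle] := ltnP p j.
    by rewrite (iter_linear_leq0 (gact_linear _) pj pS) (linear_fun0 (hprod_linear_l _)) mul0rn.
  have qj : (q < p + q - j)%N by lia.
  by rewrite (iter_linear_leq0 (gact_linear _) qj qS) (linear_fun0 (hprod_linear_r _)) mul0rn.
rewrite -scaler_nat scaler_eq0 (negPf chi0) orbF natr_eq0_char0 // -leqn0 leqNgt.
by rewrite bin_gt0 leq_addr.
Qed.
End CartanProduct.

(** * Homogeneous primes of the Cartan algebra *)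

(* Evaluating the generating polynomial of a degree at a generic integer gives an
   additive function to the integers that separates finitely many degrees. *)
Lemma separating_functional (m : nat) (xs : seq 'rV[int]_m) : exists f : 'rV[int]_m -> int,
  (forall x y, f (x + y) = f x + f y) /\
  (forall x y, x \in xs -> y \in xs -> f x = f y -> x = y).
Proof.
pose p : {poly int} := \prod_(x <- xs) \prod_(y <- xs | x != y) rVpoly (x - y).
have p0 : p != 0.
  rewrite prodf_seq_neq0; apply/allP => x _ /=.
  rewrite prodf_seq_neq0; apply/allP => y _; apply/implyP => xy.
  by apply: contra_neq xy => e; apply/subr0_eq; apply: (can_inj rVpolyK); rewrite e linear0.
have [c pc] : exists c : int, ~~ root p c.
  apply: contrapT => no; have := @max_poly_roots _ p [seq i%:Z | i <- iota 0 (size p)] p0.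
  rewrite size_map size_iota ltnn map_inj_uniq ?iota_uniq => [|i j []//]; case/(_ _ erefl)/wrap => //.
  by apply/allP => i _; apply: contrapT => /negP nr; apply: no; exists i.
exists (fun x => (rVpoly x).[c]); split; first by move=> x y; rewrite linearD hornerD.
move=> x y xs_x ys_y e; apply: contrapT => /eqP xy; move: pc; rewrite /root.
rewrite /p horner_prod (big_rem x) //= horner_prod (big_rem y) //= xy.
by rewrite linearB hornerD hornerN e subrr !mul0r eqxx.
Qed.

Lemma seq_max (T : eqType) (f : T -> int) (s : seq T) : s != [::] ->
  exists2 x, x \in s & forall y, y \in s -> f y <= f x.
Proof.
case: s => // x0 s _; elim: s x0 => [|x s IH] x0.
  by exists x0 => [|y]; rewrite inE // => /eqP ->.
have [y ys yP] := IH x; have [le|lt] := leP (f x0) (f y).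
  exists y; first by rewrite inE ys orbT.
  by move=> z; rewrite inE => /orP[/eqP -> //|/yP].
exists x0; first by rewrite inE eqxx.
move=> z; rewrite inE => /orP[/eqP ->//|/yP zy]; exact: le_trans zy (ltW lt).
Qed.

Section CartanAlgebraIdeals.
Variables (F : fieldType) (n : nat) (A : 'M[int]_n) (alpha : 'M[int]_(n, dimH A)).
Variable D : cartan_datum F alpha.
Notation L := (L D).
Notation CA := (CA D).

Lemma CA_eq (a b : CA) : (forall Lam, CA_comp a Lam = CA_comp b Lam) -> a = b.
Proof.
move=> e; apply: val_inj; apply/funext => -[Lam u].
exact: (congr1 (fun phi : rdual (L Lam) => phi u) (e Lam)).
Qed.

Lemma CA_compP Lam : linear (fun a : CA => CA_comp a Lam).
Proof. by move=> c a b; apply: rdualP. Qed.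

Lemma CA_comp_in Lam (phi : rdual (L Lam)) : CA_comp (CA_in phi) Lam = phi.
Proof. by apply: rdualP => u; exact: CA_in_funE. Qed.

Lemma CA_comp_in_neq Lam (phi : rdual (L Lam)) M : M != Lam -> CA_comp (CA_in phi) M = 0.
Proof. by move=> ne; apply: rdualP => u; exact: CA_in_funN. Qed.

Lemma CA_in_linear Lam : linear (@CA_in _ _ _ _ D Lam).
Proof.
move=> c phi psi; apply: CA_eq => M; rewrite CA_compP.
have [->|ne] := eqVneq M Lam; first by rewrite !CA_comp_in.
by rewrite !CA_comp_in_neq // scaler0 addr0.
Qed.

Lemma CA_comp_degrees (a : CA) Lam : ~ degrees a Lam -> CA_comp a Lam = 0.
Proof. by move=> na; apply: rdualP => u; apply: contrapT => /eqP nz; apply: na; exists u. Qed.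

Lemma degreesP (a : CA) : exists2 s : seq (Pplus A), uniq s & degrees a `<=` [set` s].
Proof.
have /finite_seqP[s sP] : finite_set (degrees a) by case: a => a /= /asboolP[].
by exists (undup s); rewrite ?undup_uniq // sP => Lam /=; rewrite mem_undup.
Qed.

Lemma CA_sum_in (a : CA) s : uniq s -> degrees a `<=` [set` s] ->
  a = \sum_(Lam <- s) CA_in (CA_comp a Lam).
Proof.
move=> us sP; apply: CA_eq => M; rewrite (linear_fun_sum _ _ _ (CA_compP M)).
have [Ms|Ms] := boolP (M \in s); last first.
  rewrite CA_comp_degrees; last by move=> /sP /=; rewrite (negPf Ms).
  rewrite big_seq big1 // => N Ns; rewrite CA_comp_in_neq //.
  by apply: contraNneq Ms => ->.
rewrite (bigD1_seq M) //= CA_comp_in big1 ?addr0 // => N NM.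
by rewrite CA_comp_in_neq // eq_sym.
Qed.

(** The lists may exceed the degrees, so a product and its image under pi(g) can be expanded over
    the same lists. *)
Lemma CA_mulE (a b : CA) s t : uniq s -> uniq t ->
  degrees a `<=` [set` s] -> degrees b `<=` [set` t] ->
  CA_mul a b = \sum_(Lam <- s) \sum_(N <- t) CA_in (hprod (CA_comp a Lam) (CA_comp b N)).
Proof.
move=> us ut sP tP; rewrite /CA_mul (@fsbig_fwiden _ _ _ _ s) //.
  apply: eq_bigr => Lam _; rewrite (@fsbig_fwiden _ _ _ _ t) // => N [_ /CA_comp_degrees b0] /=.
  by rewrite b0 (linear_fun0 (hprod_linear_r _)) (linear_fun0 (@CA_in_linear _)).
move=> Lam [_ /CA_comp_degrees a0] /=; apply: fsbig1 => N _.
by rewrite a0 (linear_fun0 (hprod_linear_l _)) (linear_fun0 (@CA_in_linear _)).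
Qed.

(** * Ideals given degree by degree *)

Section GradedSubspace.
Variable S : forall Lam : Pplus A, set (rdual (L Lam)).
Hypothesis S0 : forall Lam, S (0 : rdual (L Lam)).
Hypothesis SP : forall Lam c (phi psi : rdual (L Lam)), S phi -> S psi -> S (c *: phi + psi).
Hypothesis Sl : forall Lam N (phi : rdual (L Lam)) (psi : rdual (L N)),
  S psi -> S (hprod phi psi).
Hypothesis Sr : forall Lam N (phi : rdual (L Lam)) (psi : rdual (L N)),
  S phi -> S (hprod phi psi).

Lemma graded_sum Lam I (r : seq I) (Q : pred I) (G : I -> rdual (L Lam)) :
  (forall i, Q i -> S (G i)) -> S (\sum_(i <- r | Q i) G i).
Proof.
by move=> SG; elim/big_ind: _ => // phi psi Sphi Spsi; rewrite -[phi]scale1r; exact: SP.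
Qed.

Lemma dsumP c (a b : CA) : dsum S a -> dsum S b -> dsum S (c *: a + b).
Proof. by move=> Sa Sb Lam; rewrite CA_compP; apply: SP. Qed.

Lemma dsum_in Lam (phi : rdual (L Lam)) : dsum S (CA_in phi) <-> S phi.
Proof.
split=> [/(_ Lam)|Sphi M]; first by rewrite CA_comp_in.
have [->|ne] := eqVneq M Lam; first by rewrite CA_comp_in.
by rewrite CA_comp_in_neq.
Qed.

Lemma dsum_sum I (r : seq I) (Q : pred I) (G : I -> CA) :
  (forall i, Q i -> dsum S (G i)) -> dsum S (\sum_(i <- r | Q i) G i).
Proof.
move=> SG Lam; rewrite (linear_fun_sum _ _ _ (CA_compP Lam)); apply: graded_sum.
by move=> i /SG; exact.
Qed.

Lemma dsum_homogeneous_ideal : homogeneous_ideal (dsum S).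
Proof.
split; last by move=> a Lam Sa; apply/dsum_in.
split.
- by move=> Lam; rewrite (linear_fun0 (CA_compP Lam)).
- by move=> a b Sa Sb; rewrite -scaleN1r addrC; exact: dsumP.
- move=> a b Sb; have [s us sP] := degreesP a; have [t ut tP] := degreesP b.
  rewrite (CA_mulE us ut sP tP); apply: dsum_sum => Lam _; apply: dsum_sum => N _.
  by apply/dsum_in/Sl.
- move=> a b Sa; have [s us sP] := degreesP a; have [t ut tP] := degreesP b.
  rewrite (CA_mulE us ut sP tP); apply: dsum_sum => Lam _; apply: dsum_sum => N _.
  by apply/dsum_in/Sr.
Qed.

Hypothesis Sprime : forall Lam N (phi : rdual (L Lam)) (psi : rdual (L N)),
  S (hprod phi psi) -> S phi \/ S psi.

(** Leading terms modulo [S]: among the components outside [S], take [La] and [Nb] with maximal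
    value of a separating functional. Any other pair contributing to degree La + Nb has a factor in
    [S]; otherwise maximality forces equal functional values, hence equal degrees. *)
Lemma dsum_prime : (exists Lam (phi : rdual (L Lam)), ~ S phi) -> prime_ideal (dsum S).
Proof.
move=> [Lam0 [phi0 nphi0]]; split.
  by move=> ST; apply: nphi0; apply/dsum_in; rewrite ST.
move=> a b Sab; apply: contrapT => /not_orP[na nb].
have [s us sP] := degreesP a; have [t ut tP] := degreesP b.
pose bad (c : CA) (r : seq (Pplus A)) := [seq Lam <- r | ~~ `[< S (CA_comp c Lam) >]].
have badP (c : CA) (r : seq (Pplus A)) Lam : degrees c `<=` [set` r] -> ~ S (CA_comp c Lam) -> Lam \in bad c r.
  move=> rP nS; rewrite mem_filter; apply/andP; split; first by apply/asboolPn.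
  apply: contrapT => /negP nr; apply: nS; rewrite CA_comp_degrees // => /rP /=.
  by rewrite (negPf nr).
have bad0 (c : CA) (r : seq (Pplus A)) : degrees c `<=` [set` r] -> ~ dsum S c -> bad c r != [::].
  by move=> rP /existsNP[Lam /(badP _ _ _ rP)]; case: (bad c r).
have [f [fD fI]] := separating_functional (map (@Pplus_val n A) (s ++ t)).
have [La La_a LaP] := seq_max (fun Lam : Pplus A => f Lam) (bad0 _ _ sP na).
have [Nb Nb_b NbP] := seq_max (fun Lam : Pplus A => f Lam) (bad0 _ _ tP nb).
move: (La_a) (Nb_b); rewrite !mem_filter => /andP[/asboolPn nSa La_s] /andP[/asboolPn nSb Nb_t].
suff : S (hprod (CA_comp a La) (CA_comp b Nb)) by move/Sprime => [].
pose M := La + Nb.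
pose T Lam N := CA_comp (CA_in (hprod (CA_comp a Lam) (CA_comp b N))) M.
have ST Lam N : Lam \in s -> N \in t -> (Lam, N) != (La, Nb) -> S (T Lam N).
  move=> Ls Nt ne; have [SLa|nSLa] := pselect (S (CA_comp a Lam)).
    by apply: (iffRL (dsum_in _)); exact: Sr.
  have [SNb|nSNb] := pselect (S (CA_comp b N)).
    by apply: (iffRL (dsum_in _)); exact: Sl.
  rewrite /T CA_comp_in_neq //; apply: contra_neq ne => e.
  have fe : f La + f Nb = f Lam + f N by rewrite -!fD; congr f; exact: (congr1 val e).
  have leL := LaP _ (badP _ _ _ sP nSLa); have leN := NbP _ (badP _ _ _ tP nSNb).
  have mem_st (x : Pplus A) : x \in s ++ t -> (x : 'rV[int]_(dimH A)) \in (map (@Pplus_val n A) (s ++ t)).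
    by move=> xs; apply/mapP; exists x.
  have eL : f Lam = f La by lia.
  have eN : f N = f Nb by lia.
  congr (_, _); apply: val_inj; apply: fI => //=; apply: mem_st; rewrite mem_cat ?Ls ?Nt ?La_s ?Nb_t ?orbT //.
have := Sab M; rewrite (CA_mulE us ut sP tP) (linear_fun_sum _ _ _ (CA_compP M)).
rewrite (bigD1_seq La) //= (linear_fun_sum _ _ _ (CA_compP M)) (bigD1_seq Nb) //=.
rewrite CA_comp_in -addrA; set R := (X in _ + X) => SR.
have SR' : S R.
  rewrite /R -[X in X + _]scale1r; apply: SP; rewrite big_seq_cond; apply: graded_sum.
    by move=> N /andP[Nt NNb]; apply: ST => //; rewrite xpair_eqE (negPf NNb) andbF.
  move=> Lam /andP[Ls LLa]; rewrite (linear_fun_sum _ _ _ (CA_compP M)) big_seq; apply: graded_sum.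
  by move=> N Nt; apply: ST => //; rewrite xpair_eqE (negPf LLa).
by have := SP (-1) SR' SR; rewrite scaleN1r (addrC (- R)) addrK.
Qed.
End GradedSubspace.
End CartanAlgebraIdeals.

(** * The strata *)

Section Facets.
Variables (F : fieldType) (n : nat) (A : 'M[int]_n) (alpha : 'M[int]_(n, dimH A)).
Variable D : cartan_datum F alpha.
Hypothesis charF : [pchar F] =i pred0.
Hypothesis gcmA : gcm A.
Hypothesis real_alpha : realization alpha.
Notation L := (L D).
Notation CA := (CA D).
Notation P := 'rV[int]_(dimH A).

Lemma in_facetE (J : {set 'I_n}) (Lam : Pplus A) :
  in_facet J Lam <-> (forall i, i \in J -> pairing (Lam : P) (hI A int i) = 0).
Proof.
split=> [[]//|z]; split=> // i _.
by case: Lam {z} => Lam /= /forallP.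
Qed.

(** Nonnegative numbers add up to 0 only if both vanish: the facet is a face of the dominant cone.
    Left to right gives closure of the ideals under products, right to left their primality. *)
Lemma in_facetD (J : {set 'I_n}) (Lam N : Pplus A) :
  in_facet J (Lam + N) <-> in_facet J Lam /\ in_facet J N.
Proof.
split=> [/in_facetE LN|[/in_facetE zL /in_facetE zN]]; last first.
  by apply/in_facetE => i iJ; rewrite pairingDl zL // zN.
have dom (M : Pplus A) i : 0 <= pairing (M : P) (hI A int i) by case: M => M /= /forallP.
by split; apply/in_facetE => i /LN/eqP; rewrite pairingDl paddr_eq0 ?dom // => /andP[/eqP ? /eqP ?].
Qed.

Lemma in_facet0 (J : {set 'I_n}) : in_facet J (0 : Pplus A).
Proof. by apply/in_facetE => i _; rewrite pairing_hI mxE. Qed.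

Lemma in_facetU (J K : {set 'I_n}) (Lam : Pplus A) :
  in_facet (J :|: K) Lam <-> in_facet J Lam /\ in_facet K Lam.
Proof.
split=> [/in_facetE z|[/in_facetE zJ /in_facetE zK]].
  by split; apply/in_facetE => i iJ; apply: z; rewrite inE iJ ?orbT.
by apply/in_facetE => i; rewrite inE => /orP[/zJ|/zK].
Qed.

Lemma in_facetS (J K : {set 'I_n}) (Lam : Pplus A) : J \subset K ->
  in_facet K Lam -> in_facet J Lam.
Proof. by move=> /fintype.subsetP JK /in_facetE z; apply/in_facetE => i /JK /z. Qed.

Lemma facet_proper (J K : {set 'I_n}) : J \proper K ->
  exists2 Lam : Pplus A, in_facet J Lam & ~ in_facet K Lam.
Proof.
move=> /properP[_ [k kK kJ]].
(* The fundamental weight of an index k in K outside J. *)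
pose Lam : P := delta_mx 0 (lshift _ k).
have LamE i : pairing Lam (hI A int i) = (i == k)%:R.
  by rewrite pairing_hI mxE eqxx /= (inj_eq (@lshift_inj _ _)).
have dL : dominant Lam by apply/forallP => i; rewrite LamE ler0n.
exists (MkPplus dL).
  by apply/in_facetE => i iJ; rewrite /= LamE; case: eqP iJ kJ => // -> ->.
by move=> /in_facetE/(_ k kK); rewrite /= LamE eqxx.
Qed.

Lemma hwv_weight Lam : weight_space (L Lam) (inF F Lam) (hwv D Lam).
Proof. by case: (hwvP D Lam). Qed.
Lemma hwv_neq0 Lam : hwv D Lam != 0.
Proof. by case: (hwvP D Lam). Qed.

Lemma highest_weight_line Lam (u : L Lam) : weight_space (L Lam) (inF F Lam) u ->
  exists c, u = c *: hwv D Lam.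
Proof.
move=> uL; have [s [sP ->]] := fspan_weight (hwv_weight Lam) (hw_fspan (hwvP D Lam) u) uL.
exists (\sum_(p <- s) p.1); rewrite scaler_suml big_seq [RHS]big_seq.
apply: eq_bigr => p /sP /(inF_inj charF)/eqP; rewrite -subr_eq0 addrAC subrr sub0r oppr_eq0.
by move=> /eqP/(wsum_eq0 real_alpha) ->.
Qed.

(** The highest weight space is a line, so one value decides; by [hprod_hwv] this value is
    multiplicative, which makes P(J) prime without [hprod_neq0]. *)
Lemma rdual_neE Lam (phi : rdual (L Lam)) : rdual_ne phi <-> phi (hwv D Lam) = 0.
Proof.
split=> [|p0 u /highest_weight_line[c ->]]; first by apply; exact: hwv_weight.
by rewrite linearZ /= p0 scaler0.
Qed.

Lemma rdual_hw_form Lam : exists phi : rdual (L Lam), phi (hwv D Lam) != 0.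
Proof.
have sL := irreducible_weight_sum (hwvP D Lam).
have /boolp.choice[phi phiP] (u : L Lam) : exists c, wproj sL (inF F Lam) u = c *: hwv D Lam.
  by apply: highest_weight_line; exact: wproj_in.
have phi_uniq u c : wproj sL (inF F Lam) u = c *: hwv D Lam -> phi u = c.
  rewrite phiP => /eqP; rewrite -subr_eq0 -scalerBl scaler_eq0 (negPf (hwv_neq0 _)) orbF subr_eq0.
  by move/eqP.
have rphi : rdual_pred (phi : L Lam -> F^o).
  apply/asboolP; split.
    by move=> c u w; apply: phi_uniq; rewrite wproj_linear !phiP scalerA -scalerDl.
  apply: (sub_finite_set _ (finite_set1 (inF F Lam))) => mu [u umu].
  apply: contraNP => /eqP ne; apply/eqP; apply: phi_uniq.
  by rewrite (wproj_weight _ _ umu) (negPf ne) scale0r.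
exists (Rdual rphi) => /=; rewrite (phi_uniq _ 1) ?oner_neq0 //.
by rewrite (wproj_weight _ _ (hwv_weight Lam)) eqxx scale1r.
Qed.

Definition IJ_comp (J : {set 'I_n}) (Lam : Pplus A) : set (rdual (L Lam)) :=
  [set phi | in_facet J Lam -> phi = 0].
Definition PJ_comp (J : {set 'I_n}) (Lam : Pplus A) : set (rdual (L Lam)) :=
  [set phi | in_facet J Lam -> rdual_ne phi].

Lemma IJ_homogeneous_ideal J : homogeneous_ideal (IJ D J).
Proof.
apply: (@dsum_homogeneous_ideal _ _ _ _ D (IJ_comp J)) => [Lam|Lam c phi psi z z'|Lam N phi psi z|Lam N phi psi z] //.
- by move=> fL; rewrite z // z' // scaler0 addr0.
- by move=> /in_facetD[_ /z ->]; rewrite (linear_fun0 (hprod_linear_r _)).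
- by move=> /in_facetD[/z -> _]; rewrite (linear_fun0 (hprod_linear_l _)).
Qed.

Lemma IJ_prime J : prime_ideal (IJ D J).
Proof.
apply: (@dsum_prime _ _ _ _ D (IJ_comp J)) => [Lam|Lam c phi psi z z'|Lam N phi psi z|Lam N phi psi z|Lam N phi psi z|] //.
- by move=> fL; rewrite z // z' // scaler0 addr0.
- by move=> /in_facetD[_ /z ->]; rewrite (linear_fun0 (hprod_linear_r _)).
- by move=> /in_facetD[/z -> _]; rewrite (linear_fun0 (hprod_linear_l _)).
- apply: contrapT => /not_orP[/not_implyP[fL /eqP p0] /not_implyP[fN /eqP q0]].
  have /negP := hprod_neq0 charF gcmA real_alpha p0 q0; apply; apply/eqP/z.
  exact/in_facetD.
have [phi p0] := rdual_hw_form 0; exists 0, phi => /(_ (in_facet0 J)) e.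
by move: p0; rewrite e eqxx.
Qed.

Lemma PJ_homogeneous_ideal J : homogeneous_ideal (PJ D J).
Proof.
apply: (@dsum_homogeneous_ideal _ _ _ _ D (PJ_comp J)) => [Lam|Lam c phi psi z z'|Lam N phi psi z|Lam N phi psi z] fL //.
- by apply/rdual_neE; move: (z fL) (z' fL) => /rdual_neE e /rdual_neE e'; rewrite /= !fctE e e' scaler0 addr0.
- by move: fL => /in_facetD[_ /z /rdual_neE e]; apply/rdual_neE; rewrite hprod_hwv e mulr0.
- by move: fL => /in_facetD[/z /rdual_neE e _]; apply/rdual_neE; rewrite hprod_hwv e mul0r.
Qed.

Lemma PJ_prime J : prime_ideal (PJ D J).
Proof.
apply: (@dsum_prime _ _ _ _ D (PJ_comp J)) => [Lam|Lam c phi psi z z'|Lam N phi psi z|Lam N phi psi z|Lam N phi psi z|].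
- by [].
- by move=> fL; apply/rdual_neE; move: (z fL) (z' fL) => /rdual_neE e /rdual_neE e'; rewrite /= !fctE e e' scaler0 addr0.
- by move=> /in_facetD[_ /z /rdual_neE e]; apply/rdual_neE; rewrite hprod_hwv e mulr0.
- by move=> /in_facetD[/z /rdual_neE e _]; apply/rdual_neE; rewrite hprod_hwv e mul0r.
- apply: contrapT => /not_orP[/not_implyP[fL p0] /not_implyP[fN q0]].
  have /z/rdual_neE/eqP : in_facet J (Lam + N) by exact/in_facetD.
  by rewrite hprod_hwv mulf_eq0 => /orP[] /eqP/rdual_neE.
have [phi p0] := rdual_hw_form 0; exists 0, phi => /(_ (in_facet0 J)) /rdual_neE e.
by move: p0; rewrite e eqxx.
Qed.

Lemma Proj_of (Q : set CA) : homogeneous_ideal Q -> prime_ideal Q ->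
  exists R : Proj D, R = Q :> set CA.
Proof. by move=> hQ pQ; exists (MkProj (introT (asboolP _) (conj hQ pQ))). Qed.

Lemma IJ_sub_PJ J : IJ D J `<=` PJ D J.
Proof. by move=> a Ja Lam /= fL; rewrite Ja // => u _. Qed.

Lemma IJ_S (J K : {set 'I_n}) : J \subset K -> IJ D J `<=` IJ D K.
Proof. by move=> JK a Ja Lam /= /(in_facetS JK); exact: Ja. Qed.

(** A form nonzero at the highest weight vector, in a degree inside the facet of J but outside that
    of K, lies in the first ideal only. As [IJ D J] is contained in [PJ D J], this places both
    points in the stratum of J. *)
Lemma IJ_not_sub_PJ (J K : {set 'I_n}) : J \proper K -> ~ IJ D K `<=` PJ D J.
Proof.
move=> /facet_proper[Lam fJ nfK] KJ; have [phi p0] := rdual_hw_form Lam.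
have : IJ D K (CA_in phi) by apply: (iffRL (@dsum_in _ _ _ _ D (IJ_comp K) _ _ phi)).
move=> /KJ /(_ Lam fJ); rewrite CA_comp_in => /rdual_neE e.
by move: p0; rewrite e eqxx.
Qed.

Lemma Or_PJ J (Q : Proj D) : PJ D J = Q :> set CA -> Or D J Q.
Proof.
move=> PQ; split; first by rewrite /Or_bar /vanishing /= -PQ; exact: IJ_sub_PJ.
by move=> [K /= JK KQ]; apply: (IJ_not_sub_PJ JK); rewrite PQ.
Qed.

Lemma Or_IJ J (Q : Proj D) : IJ D J = Q :> set CA -> Or D J Q.
Proof.
move=> IQ; split; first by rewrite /Or_bar /vanishing /= -IQ.
move=> [K /= JK KQ]; apply: (IJ_not_sub_PJ JK); apply: subset_trans (@IJ_sub_PJ J).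
by rewrite IQ.
Qed.

Lemma Or_bar_S (J K : {set 'I_n}) : J \subset K -> Or_bar D K `<=` Or_bar D J.
Proof. by move=> JK Q; apply: subset_trans; exact: IJ_S. Qed.

(** Every dominant weight lies in the facet of the empty set, so the defining ideal is 0. *)
Lemma Or_bar_set0 : Or_bar D finset.set0 = setT.
Proof.
apply/seteqP; split=> // Q _ a a0; have [[iQ _] _] := ProjP Q.
suff -> : a = 0 by exact: ideal0.
apply: CA_eq => Lam; rewrite a0 ?(linear_fun0 (CA_compP Lam)) //.
by apply/in_facetE => i; rewrite inE.
Qed.

Lemma Or_bar_setU (J K : {set 'I_n}) : Or_bar D J `&` Or_bar D K `<=` Or_bar D (J :|: K).
Proof.
move=> Q [JQ KQ] a aJK; have [[iQ _] _] := ProjP Q.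
have QD x y : (Q : set CA) x -> (Q : set CA) y -> (Q : set CA) (x + y).
  move=> Qx Qy; rewrite -[y]opprK; apply: (idealB iQ) => //.
  by rewrite -sub0r; apply: (idealB iQ) => //; exact: ideal0.
have [s us sP] := degreesP a; rewrite (CA_sum_in us sP).
elim/big_ind: _ => [|x y|Lam _]; [exact: ideal0|exact: QD|].
have [fJ|nfJ] := pselect (in_facet J Lam); last first.
  by apply: JQ; apply: (iffRL (@dsum_in _ _ _ _ D (IJ_comp J) _ _ _)).
have [fK|nfK] := pselect (in_facet K Lam); last first.
  by apply: KQ; apply: (iffRL (@dsum_in _ _ _ _ D (IJ_comp K) _ _ _)).
rewrite aJK; last exact/in_facetU.
rewrite (linear_fun0 (@CA_in_linear _ _ _ _ D Lam)); exact: ideal0.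
Qed.

(** Among the finitely many K containing J whose closure contains Q, a maximal one has Q in its
    stratum. *)
Lemma Or_bar_cover (J : {set 'I_n}) : Or_bar D J = \bigcup_(K in [set K : {set 'I_n} | J \subset K]) Or D K.
Proof.
apply/seteqP; split=> Q; last by move=> [K /= JK [KQ _]]; exact: Or_bar_S KQ.
move=> JQ; have ex : exists K : {set 'I_n}, (J \subset K) && `[< Or_bar D K Q >].
  by exists J; rewrite fintype.subxx; apply/asboolP.
have [K /maxsetP[/andP[JK /asboolP KQ] Kmax]] :=
  ex_maxset (P := fun K => (J \subset K) && `[< Or_bar D K Q >]) ex.
exists K => //; split => // -[K' /= KK' K'Q].
suff K'E : K' = K by move: KK'; rewrite K'E fintype.properxx.
apply: Kmax; last exact: fintype.proper_sub.
by apply/andP; split; [exact: fintype.subset_trans (fintype.proper_sub KK')|exact/asboolP].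
Qed.

(** A common point lies in the closure for the union of K and K', so neither set is properly
    contained in that union. *)
Lemma Or_trivIset B : trivIset B (Or D).
Proof.
move=> K K' _ _ [Q [[KQ nK] [K'Q nK']]].
have UQ : Or_bar D (K :|: K') Q by exact: Or_bar_setU.
have K'K : K' \subset K.
  apply: contrapT => /negP h; apply: nK; exists (K :|: K') => //=.
  by rewrite properE finset.subsetUl finset.subUset fintype.subxx h.
have KK' : K \subset K'.
  apply: contrapT => /negP h; apply: nK'; exists (K :|: K') => //=.
  by rewrite properE finset.subsetUr finset.subUset fintype.subxx andbT h.
by apply/eqP; rewrite finset.eqEsubset KK' K'K.
Qed.

Lemma Or_relatively_open (J : {set 'I_n}) : exists2 U : set (Proj D), open U & Or D J = U `&` Or_bar D J.
Proof.
exists (~` \bigcup_(K in [set K : {set 'I_n} | J \proper K]) Or_bar D K); last first.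
  by rewrite /Or setDE setIC.
rewrite openC; apply: closed_bigcup; first exact: finite_finset.
move=> K _; rewrite -openC; exists (IJ D K) => //; exact: IJ_homogeneous_ideal.
Qed.

Lemma Or_bar_closure J : Or_bar D J `<=` closure (Or D J).
Proof.
move=> Q JQ B; rewrite nbhsE => -[U [[I hI UE] UQ] UB].
have [R RE] := Proj_of (IJ_homogeneous_ideal J) (IJ_prime J).
exists R; split; first by apply: Or_IJ; rewrite RE.
(* If I were contained in [IJ D J], it would be contained in Q; so an open set containing Q contains
   the generic point. *)
by apply: UB; move: UQ; rewrite UE /= /vanishing => nIQ IR; apply: nIQ; apply: subset_trans JQ; rewrite -RE.
Qed.
End Facets.

(** * Invariance under the formal group *)

Section GroupAction.
Variables (F : fieldType) (n : nat) (A : 'M[int]_n) (alpha : 'M[int]_(n, dimH A)).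
Variable D : cartan_datum F alpha.
Hypothesis charF : [pchar F] =i pred0.
Hypothesis gcmA : gcm A.
Hypothesis real_alpha : realization alpha.
Notation L := (L D).
Notation CA := (CA D).
Notation Ldual := (Ldual D charF gcmA real_alpha).

(** [rdual_Oint] rules out the fallback branch of [act_rdual], and proof irrelevance fixes the
    object. *)
Lemma act_rdualE (eta : natend F alpha) Lam (phi : rdual (L Lam)) :
  act_rdual eta phi = eta (Ldual Lam) phi.
Proof.
rewrite /act_rdual; case: pselect => [OV|[]]; last exact: omodP (Ldual Lam).
by rewrite (Prop_irrelevance OV (rdual_Oint charF gcmA real_alpha (hwvP D Lam))).
Qed.

Lemma Gfn_inverseP (g : Gfn F alpha) : Gfn_gen (Gfn_inverse g).
Proof. exact: Gfn_inv (Gfn_funP g) (Gfn_funK g) (Gfn_inverseK g). Qed.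

Definition GfnV (g : Gfn F alpha) : Gfn F alpha :=
  MkGfn (@Gfn_inverseK _ _ _ _ g) (@Gfn_funK _ _ _ _ g) (Gfn_inverseP g).

Lemma pi_hom_linear g Lam : linear (@pi_hom _ _ _ _ g (L Lam)).
Proof. by move=> c phi psi; rewrite /pi_hom !act_rdualE nat_linear. Qed.

(** The Cartan product is an equivariant bilinear map between objects, so group-likeness of the
    inverse of g applies. *)
Lemma pi_hom_hprod g Lam N (phi : rdual (L Lam)) (psi : rdual (L N)) :
  pi_hom g (hprod phi psi) = hprod (pi_hom g phi) (pi_hom g psi).
Proof.
rewrite /pi_hom !act_rdualE.
exact: (@Gfn_grouplike _ _ _ _ charF real_alpha _ (Gfn_inverseP g) (Ldual Lam) (Ldual N)
  (Ldual (Lam + N)) _ (@hprod_linear_l _ _ _ _ D Lam N) (@hprod_linear_r _ _ _ _ D Lam N)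
  (@hprod_equivariant _ _ _ _ D Lam N)).
Qed.

Lemma pi_homK g Lam : cancel (@pi_hom _ _ _ _ g (L Lam)) (@pi_hom _ _ _ _ (GfnV g) (L Lam)).
Proof. by move=> phi; rewrite /pi_hom !act_rdualE /= Gfn_inverseK. Qed.

Lemma CA_comp_pi g (a : CA) Lam : CA_comp (CA_pi g a) Lam = pi_hom g (CA_comp a Lam).
Proof. exact: rdualP. Qed.

Lemma CA_pi_linear g : linear (@CA_pi _ _ _ _ D g).
Proof. by move=> c a b; apply: CA_eq => Lam; rewrite CA_compP !CA_comp_pi CA_compP pi_hom_linear. Qed.

Lemma CA_pi_in g Lam (phi : rdual (L Lam)) : CA_pi g (CA_in phi) = CA_in (pi_hom g phi).
Proof.
apply: CA_eq => M; rewrite CA_comp_pi; have [->|ne] := eqVneq M Lam.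
  by rewrite !CA_comp_in.
by rewrite !CA_comp_in_neq // (linear_fun0 (@pi_hom_linear g _)).
Qed.

Lemma CA_piK g : cancel (@CA_pi _ _ _ _ D g) (CA_pi (GfnV g)).
Proof. by move=> a; apply: CA_eq => Lam; rewrite !CA_comp_pi pi_homK. Qed.

Lemma CA_piVK g : cancel (@CA_pi _ _ _ _ D (GfnV g)) (CA_pi g).
Proof.
move=> a; apply: CA_eq => Lam; rewrite !CA_comp_pi /pi_hom !act_rdualE /=.
by rewrite Gfn_funK.
Qed.

Lemma CA_pi_mul g (a b : CA) : CA_pi g (CA_mul a b) = CA_mul (CA_pi g a) (CA_pi g b).
Proof.
have sub (c : CA) (r : set (Pplus A)) : degrees c `<=` r -> degrees (CA_pi g c) `<=` r.
  move=> sP Lam [u nz]; apply: sP; apply: contrapT => /CA_comp_degrees c0.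
  have := congr1 (fun phi : rdual (L Lam) => phi u) (CA_comp_pi g c Lam).
  by rewrite c0 (linear_fun0 (@pi_hom_linear g _)) => /eqP; apply/negP.
have [s us sP] := degreesP a; have [t ut tP] := degreesP b.
rewrite (CA_mulE us ut sP tP) (CA_mulE us ut (sub _ _ sP) (sub _ _ tP)).
rewrite (linear_fun_sum _ _ _ (CA_pi_linear g)); apply: eq_bigr => Lam _.
rewrite (linear_fun_sum _ _ _ (CA_pi_linear g)); apply: eq_bigr => N _.
by rewrite CA_pi_in pi_hom_hprod !CA_comp_pi.
Qed.

Lemma Proj_act_Proj g (Q : Proj D) : exists R : Proj D, R = Proj_act g Q :> set CA.
Proof.
have [[iQ hQ] [QT pQ]] := ProjP Q; have lg := CA_pi_linear g.
apply: Proj_of; split.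
- split; rewrite /Proj_act /preimage /=.
  + by rewrite (linear_fun0 lg); exact: ideal0.
  + by move=> a b Qa Qb; rewrite -scaleN1r (linear_funD lg) (linear_funZ _ _ lg) scaleN1r;
      exact: idealB.
  + by move=> a b Qb; rewrite CA_pi_mul; exact: (idealMl iQ _ Qb).
  + by move=> a b Qa; rewrite CA_pi_mul; exact: (Defs.idealMr iQ _ Qa).
- move=> a Lam /= Qa; rewrite /Proj_act /preimage /= CA_pi_in -CA_comp_pi; exact: hQ.
(* Properness: [CA_pi g] is surjective, with right inverse [CA_pi (GfnV g)]. *)
- move=> e; apply: QT; apply/seteqP; split => // a _.
  have : Proj_act g Q (CA_pi (GfnV g) a) by rewrite e.
  by rewrite /Proj_act /preimage /= CA_piVK.
- by move=> a b; rewrite /Proj_act /preimage /= CA_pi_mul; exact: pQ.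
Qed.

(** The ideal consists of whole graded pieces, and pi(g) preserves degrees. *)
Lemma IJ_pi g J (a : CA) : IJ D J a -> IJ D J (CA_pi g a).
Proof. by move=> Ja Lam fJ; rewrite CA_comp_pi Ja // (linear_fun0 (@pi_hom_linear g _)). Qed.

Lemma IJ_Proj_act g J (Q : Proj D) : IJ D J `<=` Proj_act g Q <-> IJ D J `<=` Q.
Proof.
split=> JQ a Ja; last by apply: JQ; exact: IJ_pi.
by have := JQ _ (IJ_pi (GfnV g) Ja); rewrite /Proj_act /preimage /= CA_piVK.
Qed.

Lemma Or_Proj_act g J (Q R : Proj D) : R = Proj_act g Q :> set CA -> Or D J R <-> Or D J Q.
Proof.
move=> RE; have barE K : Or_bar D K R <-> Or_bar D K Q.
  by rewrite /Or_bar /vanishing /= RE; exact: IJ_Proj_act.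
by split=> -[JR nK]; split; [exact/barE| |exact/barE|]; move=> [K JK KR];
  apply: nK; exists K => //; exact/barE.
Qed.

(** [Proj_act] yields a bare set of elements, so both sides are sets of ideals; the reverse
    inclusion uses the inverse [GfnV g]. *)
Lemma Or_invariant g J : [set Proj_act g (Q : set CA) | Q in Or D J] =
  [set (Q : set CA) | Q in Or D J].
Proof.
apply/seteqP; split=> _ [Q JQ <-].
  by have [R RE] := Proj_act_Proj g Q; exists R => //; exact/(Or_Proj_act _ RE).
have [R RE] := Proj_act_Proj (GfnV g) Q.
exists R; first exact/(Or_Proj_act _ RE).
rewrite RE; apply/seteqP; split => a; rewrite /Proj_act /preimage /= CA_piK //.
Qed.
End GroupAction.

Theorem proposition3p12 (F : fieldType) (n : nat) (A : 'M[int]_n)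
    (alpha : 'M[int]_(n, dimH A)) (D : cartan_datum F alpha) (J : {set 'I_n}) :
  [pchar F] =i pred0 -> gcm A -> symmetrizable A -> realization alpha ->
  ((forall g : Gfn F alpha,
      [set Proj_act g (Q : set (CA D)) | Q in Or D J] =
      [set (Q : set (CA D)) | Q in Or D J]) /\
   (exists2 Q : Proj D, Or D J Q & PJ D J = Q :> set (CA D))) /\
  (((exists2 U : set (Proj D), open U & Or D J = U `&` Or_bar D J) /\
    Or_bar D J `<=` closure (Or D J)) /\
   (open (Or D (finset.set0 : {set 'I_n})) /\
    dense (Or D (finset.set0 : {set 'I_n})))) /\
  ((Or_bar D J = \bigcup_(K in [set K : {set 'I_n} | J \subset K]) Or D K /\
    trivIset [set K : {set 'I_n} | J \subset K] (Or D)) /\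
   ([set: Proj D] = \bigcup_(K in [set: {set 'I_n}]) Or D K /\
    trivIset [set: {set 'I_n}] (Or D))).
Proof.
move=> charF gcmA _ real_alpha.
have cl K : Or_bar D K `<=` closure (Or D K) by exact: Or_bar_closure.
split; [split|split; split].
- by move=> g; exact: Or_invariant.
- have [Q QE] := Proj_of (PJ_homogeneous_ideal D charF real_alpha J)
    (PJ_prime D charF real_alpha J).
  by exists Q => //; exact: Or_PJ.
- by split; [exact: Or_relatively_open|exact: cl].
- split.
    have [U oU ->] := Or_relatively_open D (finset.set0 : {set 'I_n}).
    by rewrite Or_bar_set0 setIT.
  move=> O [Q OQ] oO; have [||R [SR OR]] := cl finset.set0 Q _ O.
  + by rewrite Or_bar_set0.
  + by apply: open_nbhs_nbhs.
  by exists R.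
- by split; [exact: Or_bar_cover|exact: Or_trivIset].
split; last exact: Or_trivIset.
rewrite -(Or_bar_set0 D) Or_bar_cover; congr bigcup; apply/seteqP; split => // K _ /=.
exact: finset.sub0set.
Qed.
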